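(* Let $\nu\ge2$ be even and $a>0$, and consider the prepared transverse passage described in the context, with outgoing correction $\mathcal D_{\mathrm{cap}}(q,\mathbf u)$. For every compact $K\subset\mathbb R\times\mathbb R^{\nu-2}$ there are $C_K,r_K>0$ such that for $(\rho,\mathbf u)=(\rho,u_1,\dots,u_{\nu-2})\in K$ and $0<r<r_K$, the physical trajectory (launched from $(-T,r^\nu\rho)$ at parameter $(r^{\nu-1}u_1,\dots,r^2u_{\nu-2})$) stays in $\mathcal Q$, reaches $t=T$, and $$\left|\mathcal D_{\mathrm{cap}}(r^\nu\rho,r^{\nu-1}u_1,\dots,r^2u_{\nu-2})-\beta r^{\nu+1}\mathcal C_{\nu,a}(\rho,\mathbf u)\right|\le C_Kr^{\nu+2}.$$ The estimate is uniform across every polynomial discriminant stratum in $K$, including births, mergers, and disappearances of components of the positive set $\{t:\rho-at^\nu-\sum_ju_jt^j>0\}$.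
   Context: Smooth means $C^\infty$; $x_+=\max\{x,0\}$. Write $\mathbf u=(u_1,\dots,u_{\nu-2})$ (absent when $\nu=2$); the $j$-th coordinate is scaled as $r^{\nu-j}u_j$. The cap is $$\mathcal C_{\nu,a}(\rho,\mathbf u)=\int_{\mathbb R}\Bigl(\rho-at^\nu-\sum_{j=1}^{\nu-2}u_jt^j\Bigr)_+dt.$$ Prepared transverse passage. In a (sufficiently small) fixed box $\mathcal Q=[-T,T]\times(-I_*,I_* )$ with coordinates $(t,I)$, for $\mathbf u$ near $0\in\mathbb R^{\nu-2}$, the switching function is $h_{\mathbf u}(t,I)=g(t,I,\mathbf u)\,(I-\Phi_{\mathbf u}(t))$ with $g>0$ smooth, where $\Phi_{\mathbf u}(t)=a(\mathbf u)t^\nu+\sum_{j=1}^{\nu-2}u_jt^j+t^{\nu+1}R(t,\mathbf u)$, $a(0)=a$, with $a(\cdot)$ and $R$ smooth, and there is $\kappa_*>0$ with $\partial_t^\nu\Phi_{\mathbf u}(t)\ge\kappa_*$ for $|t|\le T$. The fields are $X^-_{\mathbf u}=\partial_t$ and $X^+_{\mathbf u}$ with $X^+_{\mathbf u}-X^-_{\mathbf u}=h_{\mathbf u}W_{\mathbf u}$, $W_{\mathbf u}=A_{\mathbf u}\partial_t+B_{\mathbf u}\partial_I$ (jointly smooth in $(t,I,\mathbf u)$). The physical field is $X_{\mathbf u}=\partial_t+(h_{\mathbf u})_+W_{\mathbf u}$. The leading mismatch is $\beta=dh_0(0,0)[W_0(0,0)]=g(0,0,0)B_0(0,0)$. The physical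 trajectory is launched at $(t,I)=(-T,q)$; $\mathcal D_{\mathrm{cap}}(q,\mathbf u)$ is its outgoing $I$-coordinate (at $t=T$) minus that of the reference $X^-$-trajectory (which is $q$). *)

(* Defs.v *)
From HB Require Import structures.
From mathcomp Require Import all_boot all_order all_algebra.
From mathcomp Require Import all_classical all_reals all_analysis.

Set Implicit Arguments.
Unset Strict Implicit.
Unset Printing Implicit Defensive.

Import Order.TTheory GRing.Theory Num.Theory.
Import numFieldNormedType.Exports.

Local Open Scope classical_set_scope.
Local Open Scope ring_scope.

(* On a finite-dimensional space, f is C^k on the open set O iff its iterated
   directional derivatives up to order k exist and are continuous on O. *)
Fixpoint class_C (R : realType) (V : normedModType R) (k : nat)
    (O : set V) (f : V -> R) : Prop :=
  (forall x, O x -> {for x, continuous f}) /\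
  if k is k'.+1 then
    forall v : V, (forall x, O x -> derivable f x v) /\ class_C k' O ('D_v f)
  else True.

(* Smoothness on a set A that need not be open (here a box closed in t). *)
Definition smooth_on (R : realType) (V : normedModType R)
    (A : set V) (f : V -> R) : Prop :=
  exists O : set V, [/\ open O, A `<=` O & forall k, class_C k O f].

(* The parameter (u_1, ..., u_{nu-2}) is a row vector indexed from 0: u_j is
   stored in column j - 1. *)
Definition unfolding (R : realType) (nu : nat) (u : 'rV[R]_nu.-2) (t : R) : R :=
  \sum_(j < nu.-2) u 0 j * t ^+ j.+1.

Definition rescale (R : realType) (nu : nat) (r : R) (u : 'rV[R]_nu.-2) :
    'rV[R]_nu.-2 :=
  \row_(j < nu.-2) (r ^+ (nu - j.+1) * u 0 j).

Definition cap (R : realType) (nu : nat) (a rho : R) (u : 'rV[R]_nu.-2) : R :=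
  \int[@lebesgue_measure R]_t Num.max (rho - a * t ^+ nu - unfolding u t) 0.

(* Points (t, I) are pairs; the vector field x d/dt + y d/dI is z |-> (x z, y z).
   Functions depending on the parameter take ((t, I), u) as one argument, so
   that their joint smoothness can be expressed. *)
Record passage (R : realType) (nu : nat) := Passage {
  halfT : R;
  Istar : R;
  params : set 'rV[R]_nu.-2;
  gfac : R * R * 'rV[R]_nu.-2 -> R;
  acoef : 'rV[R]_nu.-2 -> R;
  remainder : R * 'rV[R]_nu.-2 -> R;
  Acomp : R * R * 'rV[R]_nu.-2 -> R;
  Bcomp : R * R * 'rV[R]_nu.-2 -> R;
  Xplus : 'rV[R]_nu.-2 -> R * R -> R * R
}.

Section Passage.
Context (R : realType) (nu : nat) (p : passage R nu).
Implicit Types (u : 'rV[R]_nu.-2) (z : R * R) (X : R * R -> R * R).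

Definition box : set (R * R) :=
  [set z | - halfT p <= z.1 <= halfT p /\ - Istar p < z.2 < Istar p].

Definition Phi u (t : R) : R :=
  acoef p u * t ^+ nu + unfolding u t + t ^+ nu.+1 * remainder p (t, u).

Definition switching u z : R := gfac p (z, u) * (z.2 - Phi u z.1).

Definition Wfield u z : R * R := (Acomp p (z, u), Bcomp p (z, u)).

Definition Xminus z : R * R := (1, 0).

Definition Xphys u z : R * R :=
  Xminus z + Num.max (switching u z) 0 *: Wfield u z.

(* For a prepared passage this is g(0,0,0) B_0(0,0), since Phi_0 and its first
   derivative vanish at t = 0. *)
Definition mismatch : R := 'd (switching 0) (0 : R * R) (Wfield 0 0).

Definition prepared (a : R) : Prop :=
  [/\ 0 < halfT p, 0 < Istar p, open (params p) & params p 0] /\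
  [/\ smooth_on (box `*` params p) (gfac p),
      smooth_on (params p) (acoef p),
      smooth_on (`[- halfT p, halfT p] `*` params p) (remainder p),
      smooth_on (box `*` params p) (Acomp p) &
      smooth_on (box `*` params p) (Bcomp p)] /\
  [/\ forall z u, box z -> params p u -> 0 < gfac p (z, u),
      acoef p 0 = a,
      exists2 kappa : R, 0 < kappa & forall u (t : R), params p u ->
        - halfT p <= t <= halfT p -> kappa <= derive1n nu (Phi u) t &
      forall u z, params p u -> box z ->
        Xplus p u z - Xminus z = switching u z *: Wfield u z].

(* gamma, on the time interval [0, tau], is a trajectory of X in the box from
   (-T, q) until its first arrival at t = T. *)
Definition transit X (q tau : R) (gamma : R -> R * R) : Prop :=
  [/\ 0 <= tau, gamma 0 = (- halfT p, q) &
      {within `[0, tau], continuous gamma}] /\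
  [/\ forall s : R, 0 < s < tau -> is_derive s 1 gamma (X (gamma s)),
      forall s : R, 0 <= s <= tau -> box (gamma s),
      forall s : R, 0 <= s < tau -> (gamma s).1 < halfT p &
      (gamma tau).1 = halfT p].

(* Outgoing I-coordinate of the X-trajectory launched at (-T, q); the default
   value 0 is returned if that trajectory does not reach t = T. *)
Definition outgoing X (q : R) : R :=
  xget 0 [set y : R | exists tau gamma, transit X q tau gamma /\
                                        (gamma tau).2 = y].

Definition Dcap (q : R) u : R := outgoing (Xphys u) q - outgoing Xminus q.

End Passage.

(* Main.v *)
Require Import Defs.
From HB Require Import structures.
From mathcomp Require Import all_boot all_order all_algebra.
From mathcomp Require Import all_classical all_reals all_analysis.
From mathcomp Require Import ring lra.

Set Implicit Arguments.
Unset Strict Implicit.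
Unset Printing Implicit Defensive.

Import Order.TTheory GRing.Theory Num.Theory.
Import numFieldNormedType.Exports.

Local Open Scope classical_set_scope.
Local Open Scope ring_scope.

(** The displacement in I is collected only where the switching function is
positive, and in the variables t = r x, I = r^nu y that set is bounded
independently of the parameters.  Indeed Phi_u(t) - sum_j u_j t^j equals
t^nu S(t,u) with S(t,u) = a(u) + t R(t,u).  The lower bound on the nu-th
derivative makes Phi_0 positive away from 0 ([slope0_gt0]; nu is even), so by
compactness S >= c > 0 on the whole of [-T,T] for small u
([uniform_bounds_exist]).  Hence (q - Phi)_+ is O(r^nu) and vanishes for
|x| >= X, with X depending only on c and on the compact set K ([inactive],
[active_le]).

Instead of cutting the trajectory where it enters and leaves |x| <= X, the
indicator function of that window is bounded by a multiple of 1/(1 + x^2).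
Since dt/ds >= 1/2, this is at most twice the derivative of r atan(t/r) along
the motion, a function of total variation at most pi r.  Every integral
estimate thus becomes the monotonicity of a difference:
- [passage_gronwall] gives |I - q| <= C2 r^(nu+1) along the whole passage
  ([deviation]);
- inside the window gB = beta + O(r), I = q + O(r^(nu+1)),
  Phi = a t^nu + sum_j u_j t^j + O(r^(nu+1)) and dt/ds = 1 + O(r^nu).  As
  z -> z_+ is 1-Lipschitz, dI/ds differs from beta r^nu c(x) dt/ds by
  O(r^(nu+1)), where c is the integrand of the cap ([rate_error]); the
  Lipschitz bound does not see the roots of the polynomial, which is the
  reason for the uniformity across the discriminant strata;
- [passage_drift] integrates this error to O(r^(nu+2)), and the main term
  integrates to beta r^(nu+1) times the cap, an antiderivative of c providing
  an exact primitive of r^nu c(t/r) dt/ds ([leading_order]).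

These estimates hold for every transit, because a first exit argument confines
each of them to a thin strip ([transit_leading_order]); in particular they hold
for the one picked by [outgoing].  A transit exists because the field evaluated
at the point clamped to the strip is bounded and globally Lipschitz, Picard
iteration solves it ([picard_lindelof]), and the deviation bound shows that the
solution never leaves the region where clamping is the identity
([transit_exists]). *)

(** * First hitting times and barriers on the real line *)

(** The points of the segment where f >= b form a compact set, of which s is the
least element. *)
Lemma first_hit (R : realType) (f : R -> R) (a c b : R) : a <= c ->
  {within `[a, c], continuous f} -> f a < b -> b <= f c ->
  exists s, [/\ a < s, s <= c, f s = b & forall s', a <= s' < s -> f s' < b].
Proof.
move=> ac cf fab bfc.
have clA : closed (f @^-1` `[b, +oo[ : set (subspace `[a, c])).
  by apply: preimage_closed; [move=> x _; exact: cf|exact: interval_closed].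
have [V clV VA] := (closed_subspaceP _ _).1 clA.
have cA : compact (V `&` `[a, c]).
  by rewrite setIC; apply: compact_closedI => //; exact: segment_compact.
have VE x : (V x /\ `[a, c]%classic x) = (b <= f x /\ a <= x <= c).
  by have /= -> := congr1 (@^~ x) VA; rewrite !in_itv/= andbT.
have Vc : (V `&` `[a, c]) c by rewrite /setI/= VE ac lexx.
have [s] := compact_EVT_min (ex_intro _ _ Vc) cA
  (continuous_subspaceT (fun x => @cvg_id _ (nbhs x))).
move=> /set_mem; rewrite /setI/= VE => -[bfs /andP[as_ sc]] mins.
have lt_b s' : a <= s' < s -> f s' < b.
  move=> /andP[as' s's]; rewrite ltNge; apply/negP => bfs'.
  (* s is minimal among the points where f >= b. *)
  suff /mins : s' \in V `&` `[a, c] by rewrite leNgt s's.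
  by apply/mem_set; rewrite /setI/= VE bfs' as' (le_trans (ltW s's)).
have as' : a < s.
  by rewrite lt_neqAle as_ andbT; apply: contraTneq bfs => <-; rewrite -ltNge.
exists s; split => //; apply/eqP; rewrite eq_le bfs andbT.
have cfs : {within `[a, s], continuous f}.
  by apply: continuous_subspaceW cf; apply: subset_itvl; rewrite bnd_simp.
have [|x] := @IVT R f a s b as_ cfs.
  by rewrite ge_min le_max (ltW fab) bfs orbT.
rewrite in_itv/= => /andP[ax xs] fx.
suff -> : s = x by rewrite fx.
apply/eqP; rewrite eq_le xs andbT leNgt; apply/negP => xs'.
by have := lt_b x; rewrite ax xs' fx ltxx => /(_ isT).
Qed.

(** If D were positive at c, then after its last zero it would be positive, hence
nonincreasing, hence nonpositive.  This replaces Gronwall's lemma: the sign of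
the derivative has to be checked only where D is positive. *)
Lemma barrier_le0 (R : realType) (D : R -> R) (a c : R) : a <= c ->
  {within `[a, c], continuous D} -> D a <= 0 ->
  (forall s, a < s < c -> 0 < D s -> exists2 d : R, is_derive s 1 D d & d <= 0) ->
  D c <= 0.
Proof.
move=> ac cD Da dD; rewrite leNgt; apply/negP => Dc0.
have cDN : {within `[- c, - a], continuous (fun s => - D (- s))}.
  have : {within `[- c, - a], continuous (D \o -%R)}.
    by apply: within_continuous_compN; rewrite !opprK.
  by move=> h x; apply: continuousN; exact: h.
(* The last zero of D is the first zero of the reversed function. *)
have [|||| s [cs sa Ds0 lts]] := @first_hit R (fun s => - D (- s)) (- c) (- a) 0.
- by rewrite lerN2.
- exact: cDN.
- by rewrite opprK oppr_lt0.
- by rewrite opprK oppr_ge0.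
have {}cs : - s < c by rewrite ltrNl.
have {}sa : a <= - s by rewrite lerNr.
have {Ds0}D0 : D (- s) = 0 by apply/eqP; rewrite -oppr_eq0 Ds0.
have pos x : - s < x <= c -> 0 < D x.
  move=> /andP[sx xc]; have := lts (- x).
  by rewrite lerN2 xc ltrNl sx opprK oppr_lt0 => /(_ isT).
have dDx x : x \in `](- s), c[ -> is_derive x 1 D ('D_1 D x).
  rewrite in_itv/= => /andP[sx xc].
  have [||d [dx _] _] := dD x; last exact: derivableP.
    by rewrite (le_lt_trans sa).
  by apply: pos; rewrite sx ltW.
have [] := @MVT R D (fun x => 'D_1 D x) (- s) c cs dDx.
  by apply: continuous_subspaceW cD; apply: subset_itvr; rewrite bnd_simp.
move=> x; rewrite in_itv/= => /andP[sx xc].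
have [||d dx d0] := dD x; [by rewrite (le_lt_trans sa)|by apply: pos; rewrite sx ltW|].
rewrite derive_val D0 subr0 => E.
by move: Dc0; rewrite E ltNge mulr_le0_ge0// subr_ge0 ltW.
Qed.

Lemma derive_le0_le (R : realType) (D : R -> R) (a c : R) : a <= c ->
  {within `[a, c], continuous D} ->
  (forall s, a < s < c -> exists2 d : R, is_derive s 1 D d & d <= 0) ->
  D c <= D a.
Proof.
move=> ac cD dD; rewrite -subr_le0.
apply: (@barrier_le0 R (fun s => D s - D a) a c) => //.
- by move=> x; apply: continuousB; [exact: cD|exact: cvg_cst].
- by rewrite subrr.
- move=> s /dD[d dd d0] _; exists d => //.
  by rewrite -[d]subr0; apply: is_deriveB.
Qed.

(** * Functions of class C^k *)

Section ClassC.
Context {R : realType} {V : normedModType R}.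
Implicit Types (O : set V) (f g : V -> R).

Lemma class_C_continuous k O f : class_C k O f ->
  forall x, O x -> {for x, continuous f}.
Proof. by case: k => [|k] []. Qed.

Lemma class_CW k O f : class_C k.+1 O f -> class_C k O f.
Proof.
elim: k f => [|k IH] f; first by move=> [].
by move=> [cf df]; split => // v; split; [exact: (df v).1|exact/IH/(df v).2].
Qed.

(** Derivatives depend only on germs and O is open.  This allows the sum and product
rules, which hold on O only, to be iterated. *)
Lemma class_C_ext k O f g : open O -> {in O, f =1 g} -> class_C k O f ->
  class_C k O g.
Proof.
move=> oO; elim: k f g => [|k IH] f g fg.
  move=> [cf _]; split => // x Ox.
  have nx : \near x, f x = g x.
    by near=> y; apply: fg; near: y; apply: filterS (open_nbhs_nbhs (conj oO Ox)) => z; exact: mem_set.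
  rewrite /prop_for /continuous_at -(fg _ (mem_set Ox)).
  by apply: cvg_trans (cf _ Ox); apply: near_eq_cvg; apply: filterS nx.
move=> [cf df].
have nx x : O x -> \near x, f x = g x.
  move=> Ox.
  by near=> y; apply: fg; near: y; apply: filterS (open_nbhs_nbhs (conj oO Ox)) => z; exact: mem_set.
have dg v x : O x -> is_derive x v g ('D_v f x).
  move=> Ox; apply: near_eq_is_derive (nx _ Ox) _.
  by apply: derivableP; exact: (df v).1.
split.
  move=> x Ox; rewrite /prop_for /continuous_at -(fg _ (mem_set Ox)).
  by apply: cvg_trans (cf _ Ox); apply: near_eq_cvg; exact: nx.
move=> v; split; first by move=> x /(dg v)[].
apply: IH (df v).2 => x /set_mem /(dg v) dx.
by rewrite derive_val.
Unshelve. all: by end_near. Qed.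

Lemma class_CD k O f g : open O -> class_C k O f -> class_C k O g ->
  class_C k O (f \+ g).
Proof.
move=> oO; elim: k f g => [|k IH] f g [cf df] [cg dg].
  by split => // x Ox; apply: continuousD; [exact: cf|exact: cg].
split; first by move=> x Ox; apply: continuousD; [exact: cf|exact: cg].
move=> v; split => [x Ox|]; first by apply: derivableD; [exact: (df v).1|exact: (dg v).1].
apply: (@class_C_ext _ _ ('D_v f \+ 'D_v g)) => //; last exact: IH (df v).2 (dg v).2.
by move=> x /set_mem Ox; rewrite /= deriveD//; [exact: (df v).1|exact: (dg v).1].
Qed.

Lemma class_CM k O f g : open O -> class_C k O f -> class_C k O g ->
  class_C k O (f \* g).
Proof.
move=> oO; elim: k f g => [|k IH] f g Cf Cg; have [cf df] := Cf; have [cg dg] := Cg.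
  by split => // x Ox; apply: continuousM; [exact: cf|exact: cg].
split; first by move=> x Ox; apply: continuousM; [exact: cf|exact: cg].
move=> v; split => [x Ox|]; first by apply: derivableM; [exact: (df v).1|exact: (dg v).1].
apply: (@class_C_ext _ _ (f \* 'D_v g \+ g \* 'D_v f)) => //; last first.
  apply: class_CD => //; apply: IH.
  - exact: class_CW Cf.
  - exact: (dg v).2.
  - exact: class_CW Cg.
  - exact: (df v).2.
by move=> x /set_mem Ox; rewrite /= deriveM//; [exact: (df v).1|exact: (dg v).1].
Qed.

Lemma class_C_cst k O (c : R) : class_C k O (cst c).
Proof.
elim: k c => [|k IH] c; first by split => // x _; exact: cvg_cst.
split; first by move=> x _; exact: cvg_cst.
move=> v; split => [x _|]; first exact: derivable_cst.
suff -> : 'D_v (cst c) = cst (0 : R) by exact: IH.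
by apply/funext => x; rewrite derive_cst.
Qed.
End ClassC.

Lemma class_C_id (R : realType) k (O : set R) : class_C k O (id : R -> R).
Proof.
case: k => [|k]; first by split => // x _; exact: cvg_id.
split => [x _|v]; first exact: cvg_id.
split => [x _|]; first exact: derivable_id.
rewrite (_ : 'D_v id = cst v); first exact: class_C_cst.
by apply/funext => x; rewrite derive_id.
Qed.

(** The difference quotients of the restriction of f to a line are difference
quotients of f, so both derivatives exist simultaneously and agree everywhere. *)
Lemma line_quotient (R : realType) (V : normedModType R) (f : V -> R) (x v : V)
    (w t : R) :
  (fun h : R => h^-1 *: ((f \o shift (x + t *: v)) (h *: (w *: v)) - f (x + t *: v)))
  = (fun h : R => h^-1 *: (((fun t => f (x + t *: v)) \o shift t) (h *: w) - f (x + t *: v))).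
Proof.
apply/funext => h; congr (_ *: (f _ - _)).
by rewrite /= scalerA addrCA -scalerDl.
Qed.

Lemma line_derive (R : realType) (V : normedModType R) (f : V -> R) (x v : V)
    (w t d : R) :
  is_derive (x + t *: v) (w *: v) f d -> is_derive t w (fun t => f (x + t *: v)) d.
Proof.
move=> [df dE]; split; first by rewrite /derivable -line_quotient.
by rewrite -dE /derive line_quotient.
Qed.

Lemma class_C_line (R : realType) (V : normedModType R) k (O : set V)
    (f : V -> R) (x v : V) : class_C k O f ->
  class_C k [set t : R | O (x + t *: v)] (fun t => f (x + t *: v)).
Proof.
have cl : continuous (fun t : R => x + t *: v).
  by move=> t; apply: cvgD; [exact: cvg_cst|apply: cvgZr_tmp; exact: cvg_id].
elim: k f => [|k IH] f [cf df]; first by split => // t Ot; apply: continuous_comp; [exact: cl|exact: cf].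
split; first by move=> t Ot; apply: continuous_comp; [exact: cl|exact: cf].
move=> w; have dw t : O (x + t *: v) ->
    is_derive t w (fun t => f (x + t *: v)) ('D_(w *: v) f (x + t *: v)).
  by move=> Ot; apply: line_derive; apply: derivableP; exact: (df _).1.
split; first by move=> t /dw [].
suff -> : 'D_w (fun t : R => f (x + t *: v)) = (fun t : R => 'D_(w *: v) f (x + t *: v)).
  exact: IH (df _).2.
by apply/funext => t; rewrite /derive line_quotient.
Qed.

(** * Sign of a function from its first nonvanishing derivative *)

(** The form t^n S(t) is stable under derivation: its derivative is t^(n-1) times
the smooth function n S + t S'. *)
Lemma derive1n_vanish (R : realType) (O : set R) k n (S f : R -> R) :
  open O -> O 0 -> (forall m, class_C m O S) ->
  {in O, f =1 fun t => t ^+ n * S t} -> (k < n)%N -> derive1n k f 0 = 0.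
Proof.
move=> oO O0; elim: k n S f => [|k IH] n S f CS fE kn.
  by rewrite derive1n0 fE ?inE// expr0n gtn_eqF// mul0r.
case: n kn fE => [//|n] kn fE; rewrite derive1Sn.
apply: (IH n (fun t => n.+1%:R * S t + t * 'D_1 S t)) => //.
  move=> m; apply: (@class_CD _ _ _ _ (cst n.+1%:R \* S) (id \* 'D_1 S)) => //.
    by apply: class_CM => //; exact: class_C_cst.
  by apply: class_CM => //; [exact: class_C_id|exact: ((CS m.+1).2 1).2].
move=> t /[dup] Ot /set_mem Ot'.
have dS : is_derive t 1 S ('D_1 S t) by apply: derivableP; exact: ((CS 1%N).2 1).1.
have dE : is_derive t 1 (fun t => t ^+ n.+1 * S t)
    (t ^+ n.+1 * 'D_1 S t + S t * (n.+1%:R * t ^+ n)).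
  have := @is_deriveM R R (id ^+ n.+1) S t 1 _ _ _ dS.
  rewrite /= (_ : (id ^+ n.+1) * S = (fun t => t ^+ n.+1 * S t)); last first.
    by apply/funext => x; rewrite /= -[LHS]/((id ^+ n.+1) x * S x) fctE.
  by move=> h; apply: is_derive_eq; rewrite fctE /= -![_ *: _]/(_ * _) mulr1.
have : is_derive t 1 f (t ^+ n.+1 * 'D_1 S t + S t * (n.+1%:R * t ^+ n)).
  apply: near_eq_is_derive dE.
  near=> y; rewrite fE//; near: y.
  by apply: filterS (open_nbhs_nbhs (conj oO Ot')) => z; exact: mem_set.
move=> ?; rewrite derive1E derive_val exprS; ring.
Unshelve. all: by end_near. Qed.

(** The mean value theorem between 0 and t transports the sign of each derivative to
the preceding one, with one sign change per step for negative t. *)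
Lemma derive1n_sign (R : realType) (O : set R) (T kappa : R) n (f : R -> R) :
  0 < kappa -> `[- T, T] `<=` O -> class_C n O f ->
  (forall k, (k < n)%N -> derive1n k f 0 = 0) ->
  (forall t, - T <= t <= T -> kappa <= derive1n n f t) ->
  (forall t, 0 < t <= T -> 0 < f t) /\
  (forall t, - T <= t < 0 -> 0 < (-1) ^+ n * f t).
Proof.
move=> k0 TO; elim: n f => [|n IH] f Cf f0 fk.
  rewrite derive1n0 in fk; split => t /andP[t0 tT].
    by apply: lt_le_trans k0 (fk _ _); rewrite tT (le_trans _ (ltW t0))// oppr_le0 (le_trans (ltW t0)).
  rewrite expr0 mul1r; apply: lt_le_trans k0 (fk _ _); rewrite t0 (le_trans (ltW tT))//.
  by rewrite -oppr_le0 (le_trans t0)// ltW.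
have df t : - T <= t <= T -> is_derive t 1 f (derive1 f t).
  move=> tT; rewrite derive1E; apply: derivableP; apply: (Cf.2 1).1.
  by apply: TO; rewrite /= in_itv.
have cf a b : - T <= a -> b <= T -> {within `[a, b], continuous f}.
  move=> Ta bT; apply: continuous_in_subspaceT => x; rewrite inE /= in_itv/= => /andP[ax xb].
  by apply: Cf.1; apply: TO; rewrite /= in_itv/= (le_trans Ta)// (le_trans xb).
have ff0 : f 0 = 0 by have := f0 0%N; rewrite derive1n0; apply.
have [|||p1 p2] := IH (derive1 f).
- by rewrite (_ : derive1 f = 'D_1 f); [exact: (Cf.2 1).2|apply/funext => t; rewrite derive1E].
- by move=> k kn; rewrite -derive1Sn; apply: f0.
- by move=> t; rewrite -derive1Sn; exact: fk.
split => t /andP[h1 h2].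
  have T0 : - T <= 0 by rewrite oppr_le0 (le_trans (ltW h1)).
  have [x|x] := @MVT R f (derive1 f) 0 t h1 _ (cf _ _ T0 h2).
    rewrite in_itv/= => /andP[x0 xt]; apply: df.
    by rewrite (le_trans T0 (ltW x0)) (le_trans (ltW xt)).
  rewrite in_itv/= => /andP[x0 xt]; rewrite ff0 !subr0 => ->.
  by rewrite mulr_gt0// p1// x0 (le_trans (ltW xt)).
have T0 : 0 <= T by rewrite -oppr_le0 (le_trans h1)// ltW.
have [x|x] := @MVT R f (derive1 f) t 0 h2 _ (cf _ _ h1 T0).
  rewrite in_itv/= => /andP[x0 xt]; apply: df.
  by rewrite (le_trans h1 (ltW x0)) (le_trans (ltW xt)).
rewrite in_itv/= => /andP[x0 xt]; rewrite ff0 !sub0r => /eqP.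
rewrite eqr_oppLR => /eqP ->.
have -> : (-1) ^+ n.+1 * - (derive1 f x * - t) = (-1) ^+ n * derive1 f x * - t.
  by rewrite exprS; ring.
by rewrite mulr_gt0 ?oppr_gt0// p2// xt (le_trans h1 (ltW x0)).
Qed.

(** * Mean value inequalities and compactness *)

(** The mean value inequality along the direction v; the factor c is kept apart from
v so that only the derivative in the fixed direction v has to be bounded. *)
Lemma class_C_segment (R : realType) (V : normedModType R) (O : set V)
    (f : V -> R) (x v : V) (c M : R) : class_C 1 O f ->
  (forall s : R, 0 <= s <= 1 ->
    O (x + (s * c) *: v) /\ `|'D_v f (x + (s * c) *: v)| <= M) ->
  `|f (x + c *: v) - f x| <= M * `|c|.
Proof.
move=> Cf Os; pose g t := f (x + t *: v).
have dg t : O (x + t *: v) -> is_derive t 1 g ('D_v f (x + t *: v)).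
  move=> Ot; apply: line_derive; rewrite scale1r; apply: derivableP.
  exact: (Cf.2 v).1.
have dgc (s : R) : 0 <= s <= 1 ->
    is_derive s 1 (fun s : R => g (s * c)) ('D_v f (x + (s * c) *: v) * c).
  move=> /Os[Ot _]; apply: (@is_derive1_comp _ g (fun s : R => s * c)); first exact: dg.
  have -> : (fun s : R => s * c) = c \*: (id : R -> R).
    by apply/funext => y /=; rewrite mulrC.
  by apply: is_derive_eq; rewrite -[LHS]/(_ * _) mulr1.
have [||s] := @MVT R (fun s : R => g (s * c)) (fun s : R => 'D_v f (x + (s * c) *: v) * c) 0 1 ltr01.
- by move=> s; rewrite in_itv/= => /andP[s0 s1]; apply: dgc; rewrite !ltW.
- apply: continuous_in_subspaceT => s /set_mem; rewrite /= in_itv/= => /dgc ds.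
  exact/differentiable_continuous/derivable1_diffP.
- rewrite in_itv/= => /andP[s0 s1]; rewrite /g mul1r mul0r scale0r addr0 subr0 mulr1 => ->.
  by rewrite normrM ler_wpM2r//; apply: (Os s _).2; rewrite !ltW.
Qed.

Lemma compact_bound (R : realType) (X : topologicalType) (K : set X) (f : X -> R) :
  compact K -> (forall x, K x -> {for x, continuous f}) ->
  exists2 M : R, 0 < M & forall x, K x -> `|f x| <= M.
Proof.
move=> cK cf.
have /compact_bounded[M [_ hM]] : compact (f @` K).
  by apply: continuous_compact => //; apply: continuous_in_subspaceT => x /set_mem; exact: cf.
exists (`|M| + 1); first by rewrite ltr_wpDl.
move=> x Kx; apply: hM; last by exists x.
by rewrite (le_lt_trans (ler_norm _))// ltrDl.
Qed.

Lemma compact_directional_lipschitz (R : realType) (V : normedModType R)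
    (O K : set V) (f : V -> R) (v : V) :
  compact K -> K `<=` O -> class_C 1 O f ->
  exists2 L : R, 0 < L & forall x (c : R), (forall s : R, 0 <= s <= 1 -> K (x + (s * c) *: v)) ->
    `|f (x + c *: v) - f x| <= L * `|c|.
Proof.
move=> cK KO Cf.
have [x Kx|L L0 hL] := @compact_bound R V K ('D_v f) cK.
  by apply: (Cf.2 v).2.1; exact: KO.
exists L => // x c Kx; apply: (class_C_segment Cf) => s /Kx Ks.
by split; [exact: KO|exact: hL].
Qed.

Lemma compact_tube (R : realType) (X U : topologicalType) (K : set X)
    (F : X * U -> R) (u0 : U) (M : R) : compact K ->
  (forall x, K x -> {for (x, u0), continuous F}) ->
  (forall x, K x -> F (x, u0) < M) ->
  \forall u \near u0, forall x, K x -> F (x, u) < M.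
Proof.
move=> /compact_near_coveringP cK cF FM.
apply: (cK U (nbhs u0) (fun u x => F (x, u) < M)) => x Kx.
have [[A B] [/= xA uB] AB] := cF _ Kx _ (lt_nbhsl (FM _ Kx)).
by exists (A, B) => // -[x' u'] [Ax' Bu']; exact: (AB (x', u')).
Qed.

(** Class C^1 is phrased with directional derivatives, so the increment is split into
moves along one fixed direction at a time, each controlled by the mean value
inequality in a ball where the corresponding derivative is bounded. *)
Lemma class_C_lipschitz_span (R : realType) (V : normedModType R) (O : set V)
    (f : V -> R) (x : V) N (e : 'I_N -> V) :
  open O -> O x -> class_C 1 O f ->
  exists C d : R, [/\ 0 < C, 0 < d & forall c : 'I_N -> R, (forall i, `|c i| <= d) ->
    `|f (x + \sum_i c i *: e i) - f x| <= C * \sum_i `|c i|].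
Proof.
move=> oO Ox Cf; elim: N e => [|N IH] e.
  exists 1, 1; split => // c _; by rewrite !big_ord0 addr0 subrr normr0 mulr0.
have [C [d [C0 d0 hC]]] := IH (e \o widen_ord (leqnSn N)).
pose v := e ord_max.
have : \forall y \near x, O y /\ `|'D_v f y| < `|'D_v f x| + 1.
  near=> y; split; first by near: y; exact: open_nbhs_nbhs.
  near: y; have cD : {for x, continuous (fun y => `|'D_v f y|)}.
    apply: continuous_comp; last exact: norm_continuous.
    exact: (Cf.2 v).2.1.
  have h : nbhs `|'D_v f x| [set z | z < `|'D_v f x| + 1].
    by apply: lt_nbhsl; rewrite ltrDl.
  exact: (cD _ h).
move=> /nbhs_ballP[r /= r0 hr].
pose B := 1 + \sum_i `|e i|.
have B0 : 0 < B by rewrite ltr_pwDl// sumr_ge0.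
exists (C + (`|'D_v f x| + 1)), (Num.min d (r / 2 / B)); split.
- by rewrite addr_gt0// ltr_wpDl.
- by rewrite lt_min d0 !divr_gt0.
move=> c hc.
have hcd i : `|c i| <= d by have := hc i; rewrite le_min => /andP[].
have hcr i : `|c i| <= r / 2 / B by have := hc i; rewrite le_min => /andP[].
rewrite !big_ord_recr /= addrA.
set y := x + _.
have -> : f (y + c ord_max *: v) - f x = (f (y + c ord_max *: v) - f y) + (f y - f x).
  by rewrite addrA subrK.
apply: le_trans (ler_normD _ _) _; rewrite mulrDr [X in _ <= X]addrC.
have S0 : 0 <= \sum_(i < N) `|c (widen_ord (leqnSn N) i)| by rewrite sumr_ge0.
apply: lerD; last first.
  apply: le_trans (hC (fun i => c (widen_ord (leqnSn N) i)) (fun i => hcd _)) _.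
  by rewrite ler_wpM2r// lerDl addr_ge0.
have : `|f (y + c ord_max *: v) - f y| <= (`|'D_v f x| + 1) * `|c ord_max|.
  apply: (class_C_segment Cf) => s /andP[s0 s1].
  suff /hr[Oy /ltW Dy] : ball x r (y + (s * c ord_max) *: v) by [].
  rewrite -ball_normE /= /y -addrA opprD [in X in X < _]addrA subrr add0r normrN.
  apply: (@le_lt_trans _ _ (r / 2 / B * \sum_i `|e i|)).
    apply: le_trans (ler_normD _ _) _; rewrite big_ord_recr/= mulrDr lerD//.
      rewrite mulr_sumr; apply: le_trans (ler_norm_sum _ _ _) _.
      by apply: ler_sum => i _; rewrite normrZ ler_wpM2r.
    rewrite normrZ ler_wpM2r// normrM ger0_norm//.
    by apply: le_trans (hcr ord_max); rewrite ler_piMl.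
  have e0 : 0 <= \sum_i `|e i| by rewrite sumr_ge0.
  by rewrite mulrAC ltr_pdivrMr// /B; nra.
move/le_trans; apply.
by rewrite ler_wpM2r// lerDr ltW.
Unshelve. all: by end_near. Qed.

(** The first fundamental theorem, valid at points lying strictly to the right of the
base point a. *)
Lemma continuous_antiderivative (R : realType) (f : R -> R) (a x : R) :
  continuous f -> a < x ->
  is_derive x 1 (fun y => \int[@lebesgue_measure R]_(t in `[a, y]) f t) (f x).
Proof.
move=> cf ax.
have [||d dE] := @continuous_FTC1_closed R f a x (x + 1) _ _ ax (cf x).
- by rewrite ltrDl.
- apply: continuous_compact_integrable; first exact: segment_compact.
  by move=> y; apply: continuous_subspaceT.
- by rewrite -dE derive1E; exact: derivableP.
Qed.

Lemma is_derive_continuous (R : realType) (f : R -> R) (x d : R) :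
  is_derive x 1 f d -> {for x, continuous f}.
Proof. by move=> [df _]; exact/differentiable_continuous/derivable1_diffP. Qed.

Lemma derive_dominated (R : realType) (F G : R -> R) (df dg : R -> R) (c : R) :
  0 <= c -> (forall s : R, 0 <= s -> is_derive s 1 F (df s)) ->
  (forall s : R, 0 <= s -> is_derive s 1 G (dg s)) ->
  (forall s : R, 0 <= s -> `|df s| <= dg s) ->
  `|F c - F 0| <= G c - G 0.
Proof.
move=> c0 dF dG dle.
have key (H : R -> R) (dh : R -> R) : (forall s : R, 0 <= s -> is_derive s 1 H (dh s)) ->
    (forall s : R, 0 <= s -> dh s <= 0) -> H c <= H 0.
  move=> dH dh0; apply: derive_le0_le => //.
    apply: continuous_in_subspaceT => s /set_mem.
    by rewrite /= in_itv/= => /andP[/dH/is_derive_continuous].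
  by move=> s /andP[/ltW s0 _]; exists (dh s); [exact: dH|exact: dh0].
rewrite ler_norml; apply/andP; split.
  suff : - F c - G c <= - F 0 - G 0 by lra.
  apply: (key (fun s => - F s - G s) (fun s => - df s - dg s)) => s s0.
    by apply: is_deriveB; [apply: is_deriveN; exact: dF|exact: dG].
  by move: (dle s s0); rewrite ler_norml => /andP[]; lra.
suff : F c - G c <= F 0 - G 0 by lra.
apply: (key (fun s => F s - G s) (fun s => df s - dg s)) => s s0.
  by apply: is_deriveB; [exact: dF|exact: dG].
by move: (dle s s0); rewrite ler_norml => /andP[]; lra.
Qed.

Lemma half_pow_small (R : realType) (x y E : R) :
  (forall n, x <= y + E / 2 ^+ n) -> x <= y.
Proof.
move=> h; apply/ler_addgt0Pr => e e0.
have [n nE] : exists n : nat, E / e < n%:R.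
  by exists (Num.bound `|E / e|); rewrite (le_lt_trans (ler_norm _))// archi_boundP.
apply: le_trans (h n) _; rewrite lerD2l ler_pdivrMr ?exprn_gt0//.
rewrite mulrC -ler_pdivrMr//; apply: le_trans (ltW nE) _.
by rewrite -natrX ler_nat ltnW// ltn_expl.
Qed.

(** The limit is the supremum of the lower bounds u n - 2 E / 2^n. *)
Lemma geometric_limit (R : realType) (u : nat -> R) (E : R) : 0 <= E ->
  (forall n, `|u n.+1 - u n| <= E / 2 ^+ n) ->
  exists l, forall n, `|l - u n| <= 2 * E / 2 ^+ n.
Proof.
move=> E0 hu.
have p2 n : 0 < (2 : R) ^+ n by rewrite exprn_gt0.
have mono n k : `|u (n + k)%N - u n| <= 2 * E / 2 ^+ n - 2 * E / 2 ^+ (n + k).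
  elim: k => [|k IH]; first by rewrite addn0 !subrr normr0.
  rewrite addnS; have -> : u (n + k).+1 - u n = (u (n + k).+1 - u (n + k)%N) + (u (n + k)%N - u n).
    by rewrite addrA subrK.
  apply: le_trans (ler_normD _ _) _.
  apply: le_trans (lerD (hu _) IH) _.
  rewrite [2 ^+ (n + k).+1]exprS le_eqVlt; apply/orP; left; apply/eqP; field.
  by rewrite !expf_neq0.
(* Tail of the geometric series, started at n. *)
pose w n := 2 * E / 2 ^+ n.
have mono' n m : (n <= m)%N -> `|u m - u n| <= w n.
  move=> /subnKC <-; apply: le_trans (mono _ _) _.
  by rewrite /w lerBlDr lerDl divr_ge0 ?mulr_ge0 // ltW.
have w0 n : 0 <= w n by rewrite /w divr_ge0 ?mulr_ge0 // ltW.
have cross n m : u n - w n <= u m + w m.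
  have [nm|/ltnW mn] := leqP n m.
    by have := mono' _ _ nm; have := w0 m; rewrite ler_norml; lra.
  by have := mono' _ _ mn; have := w0 n; rewrite ler_norml; lra.
pose A := range (fun n => u n - w n).
have A0 : A !=set0 by exists (u 0%N - w 0%N), 0%N.
exists (sup A) => n; rewrite ler_distlC -/(w n); apply/andP; split.
  by rewrite lerBlDr; apply: ge_sup => // _ [m _ <-].
rewrite -lerBlDr; apply: ub_le_sup; last by exists n.
by exists (u 0%N + w 0%N) => _ [m _ <-].
Qed.

(** * Existence of solutions for bounded Lipschitz fields *)

Section Picard.
Context {R : realType} {I : finType}.
Variables (P : I -> (I -> R) -> R) (z0 : I -> R) (L M : R).
Hypothesis L0 : 0 < L.
Hypothesis Pbd : forall i z, `|P i z| <= M.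
Hypothesis Plip : forall i z z', `|P i z - P i z'| <= L * \sum_j `|z j - z' j|.

(** Solutions are controlled for s >= 0 only.  Freezing them at their initial value
for s < 0 gives integrands that are continuous on the whole line. *)
Definition forward_continuous (z : R -> I -> R) :=
  forall i, continuous (fun s : R => z (Num.max s 0) i).

(** The integral starts at -1 and not at 0, so that s = 0 is interior and the
two-sided derivative exists there as well. *)
Definition picard_step (z : R -> I -> R) (s : R) (i : I) : R :=
  let F y := \int[@lebesgue_measure R]_(t in `[-1, y]) P i (z (Num.max t 0)) in
  z0 i + (F s - F 0).

Lemma continuous_max0 : continuous (fun s : R => Num.max s 0).
Proof. by move=> s; apply: continuous_max; [exact: cvg_id|exact: cvg_cst]. Qed.

Lemma picard_step_derive z i (s : R) : forward_continuous z -> 0 <= s ->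
  is_derive s 1 (fun s : R => picard_step z s i) (P i (z s)).
Proof.
move=> cz s0.
have cP : continuous (fun t : R => P i (z (Num.max t 0))).
  move=> t; apply/cvgrPdist_lt => e e0.
  have cS : continuous (fun t' : R => L * \sum_j `|z (Num.max t 0) j - z (Num.max t' 0) j|).
    move=> t'; apply: cvgMl_tmp; apply: cvg_big => [|j _]; [exact: add_continuous|apply: cvg_norm].
    by apply: cvgB; [exact: cvg_cst|exact: cz].
  have h : nbhs (L * \sum_j `|z (Num.max t 0) j - z (Num.max t 0) j|) [set y | y < e].
    apply: lt_nbhsl; rewrite big1 ?mulr0// => j _.
    by rewrite subrr normr0.
  by apply: (@filterS _ (nbhs t) _ _ _ _ (cS t _ h)) => t'; exact: le_lt_trans (Plip _ _ _).
have s1 : -1 < s by apply: lt_le_trans s0; rewrite oppr_lt0.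
have := continuous_antiderivative cP s1.
rewrite (max_idPl s0) => dF.
pose k0 := \int[@lebesgue_measure R]_(t in `[-1, 0]) P i (z (Num.max t 0)).
have h1 := @is_deriveB R R R _ (cst k0) s 1 _ _ dF (is_derive_cst _ _ _).
have := is_deriveD (is_derive_cst (z0 i) s 1) h1.
by rewrite subr0 add0r.
Qed.

Lemma picard_step0 z i : picard_step z 0 i = z0 i.
Proof. by rewrite /picard_step subrr addr0. Qed.

Lemma forward_continuous_picard z : forward_continuous z -> forward_continuous (picard_step z).
Proof.
move=> cz i s; apply: (@continuous_comp _ _ _ (fun s : R => Num.max s 0) (fun s => picard_step z s i)).
  exact: continuous_max0.
by apply: is_derive_continuous; apply: picard_step_derive => //; rewrite le_max lexx orbT.
Qed.

Let lam : R := 2 * L * (#|I|.+1)%:R.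

Let lam0 : 0 < lam. Proof. by rewrite /lam !mulr_gt0. Qed.

(** One application of the step halves distances measured with the weight
exp (lam s): integrating the Lipschitz bound divides by lam, and lam is at least
2 L times the number of unknowns. *)
Lemma picard_step_contraction z z' (E : R) :
  forward_continuous z -> forward_continuous z' -> 0 <= E ->
  (forall s, 0 <= s -> \sum_j `|z s j - z' s j| <= E * expR (lam * s)) ->
  forall s, 0 <= s ->
    \sum_j `|picard_step z s j - picard_step z' s j| <= E / 2 * expR (lam * s).
Proof.
move=> cz cz' E0 hz s s0.
have dexp (x : R) : is_derive x 1 (fun x => L * E / lam * expR (lam * x)) (L * (E * expR (lam * x))).
  have h1 : is_derive x 1 (fun x : R => lam * x) lam.
    have := is_deriveZ lam (is_derive_id x (1 : R)).
    by rewrite -[lam *: 1]/(lam * 1) mulr1.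
  have := is_deriveZ (L * E / lam) (is_derive1_comp (is_derive_expR (lam * x)) h1).
  rewrite -[_ *: _]/(_ * _).
  have -> : L * E / lam * (expR (lam * x) * lam) = L * (E * expR (lam * x)).
    by field; rewrite gt_eqF.
  by [].
have hj j : `|picard_step z s j - picard_step z' s j| <= L * E / lam * expR (lam * s).
  have := @derive_dominated R (fun s => picard_step z s j - picard_step z' s j)
     (fun x => L * E / lam * expR (lam * x)) (fun x => P j (z x) - P j (z' x))
      (fun x => L * (E * expR (lam * x))) s s0.
  rewrite !picard_step0 subrr subr0 mulr0 expR0 mulr1 => h.
  apply: (le_trans (h _ _ _)).
  - by move=> x x0; apply: is_deriveB; exact: picard_step_derive.
  - by move=> x x0; apply: le_trans (Plip _ _ _) _; rewrite ler_pM2l// hz.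
  - by rewrite gerBl divr_ge0// ?(ltW lam0)// mulr_ge0// ltW.
apply: le_trans (ler_sum _ (fun j _ => hj j)) _.
rewrite sumr_const -[X in X <= _]mulr_natl mulrA ler_wpM2r ?expR_ge0//.
have -> : #|I|%:R * (L * E / lam) = #|I|%:R / (#|I|.+1)%:R * (E / 2).
  by rewrite /lam; field; rewrite gt_eqF//= gt_eqF.
by rewrite ler_piMl ?divr_ge0// ler_pdivrMr// mul1r ler_nat.
Qed.

Definition picard_iter n := iter n picard_step (fun _ => z0).

Lemma forward_continuous_iter n : forward_continuous (picard_iter n).
Proof.
by elim: n => [|n IH]; [move=> i s; exact: cvg_cst|exact: forward_continuous_picard].
Qed.

Lemma picard_iter_geometric : exists2 E : R, 0 <= E & forall n s, 0 <= s ->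
  \sum_j `|picard_iter n.+1 s j - picard_iter n s j| <= E / 2 ^+ n * expR (lam * s).
Proof.
(* The first increment is at most M s, hence at most (M / lam) exp (lam s), in
   each of the #|I| components. *)
pose E := #|I|%:R * (`|M| / lam).
have E0 : 0 <= E by rewrite /E mulr_ge0// divr_ge0// ltW.
exists E => //; elim=> [|n IH] s s0.
  rewrite expr0 divr1 /=.
  have hj j : `|picard_step (fun=> z0) s j - z0 j| <= `|M| / lam * expR (lam * s).
    have := @derive_dominated R (fun s => picard_step (fun=> z0) s j)
       (fun x => `|M| * x) (fun x => P j z0) (fun x => `|M|) s s0.
    rewrite picard_step0 mulr0 subr0 => h; apply: (le_trans (h _ _ _)).
    - by move=> x x0; apply: picard_step_derive => // i t; exact: cvg_cst.
    - move=> x _; have := is_deriveZ `|M| (is_derive_id x (1 : R)).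
      by rewrite -[_ *: 1]/(_ * 1) mulr1.
    - by move=> x _; apply: le_trans (Pbd _ _) (ler_norm _).
    - rewrite -mulrA ler_wpM2l// ler_pdivlMl//.
      by apply: le_trans (expR_ge1Dx _); rewrite lerDr.
  by apply: le_trans (ler_sum _ (fun j _ => hj j)) _; rewrite sumr_const -[X in X <= _]mulr_natl mulrA.
have -> : E / 2 ^+ n.+1 = E / 2 ^+ n / 2 by rewrite exprSr invfM mulrA.
apply: picard_step_contraction => //.
- exact: forward_continuous_iter n.+1.
- exact: forward_continuous_iter n.
- by rewrite divr_ge0// exprn_ge0.
Qed.

(** Global forward existence for a bounded Lipschitz field.  The iterates converge pointwise
at the rate 2^-n; being uniformly Lipschitz in s, they have a continuous limit,
which is then a fixed point of the step. *)
Lemma picard_lindelof : exists z : R -> I -> R,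
  (forall i, z 0 i = z0 i) /\
  forall (s : R) i, 0 <= s -> is_derive s 1 (fun s : R => z s i) (P i (z s)).
Proof.
have [E E0 hE] := picard_iter_geometric.
pose w s := E * expR (lam * s).
have w0 s : 0 <= w s by rewrite mulr_ge0 ?expR_ge0.
have hEj n s j : 0 <= s -> `|picard_iter n.+1 s j - picard_iter n s j| <= w s / 2 ^+ n.
  move=> s0; rewrite /w mulrAC; apply: le_trans (hE n s s0).
  by rewrite (bigD1 j)//= lerDl sumr_ge0.
have /choice[y hy] (sj : R * I) : exists l, 0 <= sj.1 ->
    forall n, `|l - picard_iter n sj.1 sj.2| <= 2 * w sj.1 / 2 ^+ n.
  have [s0|s0] := leP 0 sj.1; last by exists 0.
  by have [l hl] := geometric_limit (w0 sj.1) (fun n => hEj n sj.1 sj.2 s0); exists l.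
pose z s j := y (s, j).
have hz n (s : R) j : 0 <= s -> `|z s j - picard_iter n s j| <= 2 * w s / 2 ^+ n.
  by move=> s0; exact: hy (s, j) s0 n.
(* The iterates have a common Lipschitz constant in s since P is bounded by M. *)
have lip n j (s t : R) : 0 <= s -> 0 <= t ->
    `|picard_iter n s j - picard_iter n t j| <= `|M| * `|s - t|.
  wlog ts : s t / t <= s.
    move=> H s0 t0; have [|/ltW] := leP t s; first by move/H; apply.
    by rewrite distrC [X in _ <= _ * X]distrC => /H; apply.
  move=> s0 t0; case: n => [|n]; first by rewrite subrr normr0 mulr_ge0.
  have st0 : 0 <= s - t by rewrite subr_ge0.
  have shift (x : R) : is_derive x 1 (fun x : R => x + t) 1.
    by have := is_derive_shift x 1 t.
  have := @derive_dominated R (fun x => picard_iter n.+1 (x + t) j) (fun x => `|M| * x)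
    (fun x => P j (picard_iter n (x + t))) (fun x => `|M|) (s - t) st0.
  rewrite add0r subrK mulr0 subr0 [`|s - t|]ger0_norm//; apply.
  - move=> x x0; have xt : 0 <= x + t by rewrite addr_ge0.
    have := @is_derive1_comp R (fun x => picard_iter n.+1 x j) (fun x => x + t) x _ _
      (picard_step_derive j (@forward_continuous_iter n) xt) (shift x).
    by rewrite mulr1.
  - move=> x _; have := is_deriveZ `|M| (is_derive_id x (1 : R)).
    by rewrite -[_ *: 1]/(_ * 1) mulr1.
  - by move=> x _; apply: le_trans (Pbd _ _) (ler_norm _).
have zlip j (s t : R) : 0 <= s -> 0 <= t -> `|z s j - z t j| <= `|M| * `|s - t|.
  move=> s0 t0; apply: (@half_pow_small _ _ _ (2 * w s + 2 * w t)) => n.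
  rewrite mulrDl; have := hz n s j s0; have := hz n t j t0; have := lip n j s t s0 t0.
  by rewrite !ler_norml => /andP[a1 a2] /andP[b1 b2] /andP[c1 c2]; apply/andP; split; lra.
have cz : forward_continuous z.
  move=> j s; apply/cvgrPdist_lt => e e0.
  have M1 : 0 < `|M| + 1 by rewrite ltr_wpDl.
  have cm := @continuous_max0 s.
  near=> t; apply: le_lt_trans (zlip _ _ _ _ _) _; rewrite ?le_max ?lexx ?orbT//.
  apply: (@le_lt_trans _ _ ((`|M| + 1) * `|Num.max s 0 - Num.max t 0|)).
    by rewrite ler_wpM2r// lerDl.
  rewrite mulrC -ltr_pdivlMr//; near: t.
  by move/cvgrPdist_lt : cm; apply; rewrite divr_gt0.
have zE (s : R) j : 0 <= s -> picard_step z s j = z s j.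
  move=> s0; apply/eqP; rewrite -subr_eq0 -normr_eq0 eq_le normr_ge0 andbT.
  apply: (@half_pow_small _ _ _ (E * #|I|%:R * expR (lam * s) + w s)) => n; rewrite add0r.
  have h1 : \sum_j `|picard_step z s j - picard_iter n.+1 s j| <=
     E * #|I|%:R * 2 / 2 ^+ n / 2 * expR (lam * s).
    apply: picard_step_contraction => //.
    - exact: forward_continuous_iter.
    - by rewrite divr_ge0 ?mulr_ge0 ?exprn_ge0.
    move=> t t0; apply: le_trans (ler_sum _ (fun j _ => hz n t j t0)) _.
    by rewrite sumr_const -[X in X <= _]mulr_natl le_eqVlt; apply/orP; left; apply/eqP; rewrite /w; ring.
  have h2 := hz n.+1 s j s0.
  have h3 : `|picard_step z s j - picard_iter n.+1 s j| <=
      E * #|I|%:R * 2 / 2 ^+ n / 2 * expR (lam * s).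
    by apply: le_trans h1; rewrite (bigD1 j)//= lerDl sumr_ge0.
  have -> : picard_step z s j - z s j =
      (picard_step z s j - picard_iter n.+1 s j) - (z s j - picard_iter n.+1 s j).
    by rewrite opprB addrA subrK.
  apply: le_trans (ler_normB _ _) _; apply: le_trans (lerD h3 h2) _.
  rewrite exprS le_eqVlt; apply/orP; left; apply/eqP; field.
  by rewrite expf_neq0.
exists (picard_step z); split; first by move=> i; exact: picard_step0.
move=> s i s0; have := picard_step_derive i cz s0.
by rewrite (_ : picard_step z s = z s)//; apply/funext => j; exact: zE.
Unshelve. all: by end_near. Qed.
End Picard.

Lemma class_C_sub (R : realType) (V : normedModType R) k (O O' : set V) (f : V -> R) :
  O' `<=` O -> class_C k O f -> class_C k O' f.
Proof.
move=> OO; elim: k f => [|k IH] f [cf df]; split => //; try by move=> x /OO/cf.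
by move=> v; split; [move=> x /OO/(df v).1|exact: IH (df v).2].
Qed.

Lemma class_C_lipschitz (R : realType) (V : normedModType R) (O : set V)
    (f : V -> R) (x : V) (I : finType) (e : I -> V) :
  open O -> O x -> class_C 1 O f ->
  exists C d : R, [/\ 0 < C, 0 < d & forall c : I -> R, (forall i, `|c i| <= d) ->
    `|f (x + \sum_i c i *: e i) - f x| <= C * \sum_i `|c i|].
Proof.
move=> oO Ox Cf.
have [C [d [C0 d0 h]]] := class_C_lipschitz_span (fun i : 'I_#|I| => e (enum_val i)) oO Ox Cf.
exists C, d; split => // c hc.
have := h (fun i => c (enum_val i)) (fun i => hc _).
by rewrite !(reindex (@enum_val I I) (onW_bij _ (@enum_val_bij I))).
Qed.

(** In the applications the compact set carries the phase variables and u0 is a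
parameter: a bound at u0 persists, up to 1, for all nearby parameters at once. *)
Lemma compact_bound_near (R : realType) (X U : topologicalType) (K : set X)
    (F : X * U -> R) (u0 : U) : compact K ->
  (forall x, K x -> {for (x, u0), continuous F}) ->
  exists2 M : R, 0 < M & \forall u \near u0, forall x, K x -> `|F (x, u)| <= M.
Proof.
move=> cK cF.
have [x Kx|M M0 hM] := @compact_bound R X K (fun x => F (x, u0)) cK.
  apply: (@continuous_comp _ _ _ (fun x => (x, u0)) F); last exact: cF.
  by apply: cvg_pair; [exact: cvg_id|exact: cvg_cst].
exists (M + 1); first by rewrite addr_gt0.
have := @compact_tube R X U K (fun xu => `|F xu|) u0 (M + 1) cK.
move=> /(_ _ _)/filterS; apply.
- by move=> u h x Kx; apply/ltW/h.
- by move=> x Kx; apply: continuous_comp; [exact: cF|exact: norm_continuous].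
- by move=> x /hM h; rewrite (le_lt_trans h)// ltrDl.
Qed.

Lemma rV_nbhs_coord (R : realType) n (u0 : 'rV[R]_n) (P : set 'rV[R]_n) :
  nbhs u0 P -> exists2 d : R, 0 < d &
    forall u : 'rV[R]_n, (forall j, `|u 0 j - u0 0 j| <= d) -> P u.
Proof.
move=> /nbhs_ballP[e /= e0 he]; exists (e / 2); first by rewrite divr_gt0.
move=> u hu; apply: he; split => // i j; rewrite ord1 -ball_normE /= distrC.
by apply: le_lt_trans (hu j) _; lra.
Qed.

(** * Uniform bounds for a prepared passage *)

Section Setup.
Context {R : realType} {nu : nat} (p : passage R nu) (a : R).
Hypothesis nue : ~~ odd nu.
Hypothesis a0 : 0 < a.
Hypothesis prep : prepared p a.

Let T := halfT p.

Lemma unfolding0 t : unfolding (0 : 'rV[R]_nu.-2) t = 0.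
Proof. by rewrite /unfolding big1// => j _; rewrite mxE mul0r. Qed.

(** Phi_0 = t^nu (a + t R) has vanishing derivatives at 0 up to the order nu - 1 and a
positive nu-th derivative, so it has the sign of t^nu, which is positive. *)
Lemma slope0_gt0 t : - T <= t <= T -> 0 < a + t * remainder p (t, 0).
Proof.
move: prep => -[[T0 I0 oP P0] [[_ _ [OR [oOR subR CR]] _ _] [_ aE [kap k0 hk] _]]].
rewrite -/T in T0 subR hk.
have E : (fun t : R => remainder p ((0 : R, 0 : 'rV[R]_nu.-2) + t *: (1 : R, 0 : 'rV[R]_nu.-2)))
    = (fun t => remainder p (t, 0)).
  apply/funext => x; congr (remainder p (_, _)) => /=; last by rewrite scaler0 addr0.
  by rewrite add0r -[_ *: _]/(_ * 1) mulr1.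
pose O := [set t : R | OR ((0 : R, 0 : 'rV[R]_nu.-2) + t *: (1 : R, 0 : 'rV[R]_nu.-2))].
have OE x : O x = OR (x, 0).
  congr (OR (_, _)) => /=; last by rewrite scaler0 addr0.
  by rewrite add0r -[_ *: _]/(_ * 1) mulr1.
have oO : open O.
  apply: (@open_comp _ _ (fun t : R => (0 : R, 0 : 'rV[R]_nu.-2) + t *: (1 : R, 0 : 'rV[R]_nu.-2)) OR) => //.
  move=> y _; apply: cvgD; first exact: cvg_cst.
  by apply: cvgZr_tmp; exact: cvg_id.
(* O is a neighbourhood of [-T, T] on which t -> R(t, 0) is smooth. *)
have TO : `[- T, T] `<=` O by move=> x Tx; rewrite OE; apply: subR.
have O0 : O 0 by apply: TO; rewrite /= in_itv/= oppr_le0 !ltW.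
have CS m : class_C m O (fun t => a + t * remainder p (t, 0)).
  apply: (@class_CD _ _ _ _ (cst a) (id \* (fun t => remainder p (t, 0)))) => //.
    exact: class_C_cst.
  apply: class_CM => //; first exact: class_C_id.
  by rewrite -E; exact: class_C_line (CR m).
have PE : Phi p 0 = (fun t => t ^+ nu * (a + t * remainder p (t, 0))).
  apply/funext => x; rewrite /Phi unfolding0 aE exprS; ring.
have CP m : class_C m O (Phi p 0).
  rewrite PE; apply: (@class_CM _ _ _ _ (fun t : R => t ^+ nu)
    (fun t : R => a + t * remainder p (t, 0))) => //.
  elim: (nu) => [|k IH]; first by rewrite (_ : (fun=> _) = cst 1) //; exact: class_C_cst.
  rewrite (_ : (fun t => _) = id \* (fun t => t ^+ k)); last by apply/funext => x; rewrite exprS.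
  by apply: class_CM => //; exact: class_C_id.
have [|ppos pneg] := @derive1n_sign R O T kap nu (Phi p 0) k0 TO (CP nu) _ (fun t => hk 0 t P0).
  move=> k kn; apply: (derive1n_vanish oO O0 CS _ kn) => x _.
  by rewrite PE.
move=> /andP[Tt tT]; have [t0|t0|->] := ltrgt0P t; last by rewrite mul0r addr0.
  have := ppos t; rewrite t0 tT PE => /(_ isT).
  by rewrite pmulr_rgt0// exprn_gt0.
have := pneg t; rewrite t0 Tt PE => /(_ isT).
rewrite -signr_odd (negbTE nue) expr0 mul1r pmulr_rgt0//.
by rewrite exprn_even_gt0// (lt_eqF t0) orbT.
Qed.
End Setup.

Lemma continuous_pairr (X U : topologicalType) (u : U) : continuous (fun x : X => (x, u)).
Proof. by move=> x; apply: cvg_pair; [exact: cvg_id|exact: cvg_cst]. Qed.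

(** What the passage estimates retain of the smoothness hypotheses: constants valid
for all parameters in a cube around 0, on the half-height box. *)
Definition uniform_bounds (R : realType) (nu : nat) (p : passage R nu)
    (a M c d L : R) : Prop :=
  [/\ 0 < M, 0 < c, 0 < d, 0 < L &
  forall u : 'rV[R]_nu.-2, (forall j, `|u 0 j| <= d) ->
  [/\ params p u,
      forall z : R * R, - halfT p <= z.1 <= halfT p ->
        - (Istar p / 2) <= z.2 <= Istar p / 2 ->
        [/\ 0 < gfac p (z, u), gfac p (z, u) <= M,
            `|Acomp p (z, u)| <= M & `|Bcomp p (z, u)| <= M],
      forall t : R, - halfT p <= t <= halfT p ->
        `|remainder p (t, u)| <= M /\ c <= acoef p u + t * remainder p (t, u),
      `|acoef p u - a| <= L * \sum_j `|u 0 j| &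
      forall t y : R, `|t| <= d -> `|y| <= d ->
        `|gfac p ((t, y), u) * Bcomp p ((t, y), u) - gfac p 0 * Bcomp p 0| <=
          L * (`|t| + `|y| + \sum_j `|u 0 j|)]].

Section Bounds.
Context {R : realType} {nu : nat} (p : passage R nu) (a : R).
Hypothesis nue : ~~ odd nu.
Hypothesis a0 : 0 < a.
Hypothesis prep : prepared p a.
Let T := halfT p.
Let b := Istar p / 2.

Definition half_box : set (R * R) := `[- T, T] `*` `[- b, b].

Lemma half_box_compact : compact half_box.
Proof. by apply: compact_setX; exact: segment_compact. Qed.

Lemma half_box_sub : half_box `<=` box p.
Proof.
have [[_ I0 _ _] _] := prep.
move=> z [/=]; rewrite !in_itv/= => h1 /andP[h2 h3]; split => //.
by rewrite /b in h2 h3; apply/andP; split; lra.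
Qed.

Lemma smooth_on_bound (f : R * R * 'rV[R]_nu.-2 -> R) :
  smooth_on (box p `*` params p) f ->
  exists2 M : R, 0 < M & \forall u \near (0 : 'rV[R]_nu.-2),
    forall z, half_box z -> `|f (z, u)| <= M.
Proof.
have [[_ I0 _ P0] _] := prep.
move=> [Q [oQ sub C]]; apply: compact_bound_near; first exact: half_box_compact.
move=> z zb; apply: (class_C_continuous (C 0%N)).
by apply: sub; split => //=; exact: half_box_sub.
Qed.

Lemma smooth_on_class (V : normedModType R) (A : set V) (f : V -> R) k :
  smooth_on A f -> exists O : set V, [/\ open O, A `<=` O & class_C k O f].
Proof. by move=> [Q [oQ AQ C]]; exists Q; split => //; exact: C. Qed.

Lemma remainder_bound : exists M c : R, [/\ 0 < M, 0 < c &
  \forall u \near (0 : 'rV[R]_nu.-2), forall t : R, - T <= t <= T ->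
     `|remainder p (t, u)| <= M /\ c <= acoef p u + t * remainder p (t, u)].
Proof.
have [[T0 I0 _ P0] [[_ Ca CR _ _] [_ aE _ _]]] := prep.
have cK : compact `[- T, T] by exact: segment_compact.
have [OR [oOR ORsub CR1]] := smooth_on_class 0 CR.
have [Oa [oOa Oasub Ca1]] := smooth_on_class 0 Ca.
have cR t : `[- T, T]%classic t -> {for (t, 0 : 'rV[R]_nu.-2), continuous (remainder p)}.
  by move=> tT; apply: (class_C_continuous CR1); exact: ORsub.
have [M M0 hM] := compact_bound_near cK cR.
pose S (tu : R * 'rV[R]_nu.-2) := acoef p tu.2 + tu.1 * remainder p tu.
have cS t : `[- T, T]%classic t -> {for (t, 0 : 'rV[R]_nu.-2), continuous S}.
  move=> tT; apply: cvgD.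
    apply: (@continuous_comp _ _ _ snd (acoef p)); first exact: cvg_snd.
    by apply: (class_C_continuous Ca1); exact: Oasub.
  by apply: cvgM; [exact: cvg_fst|exact: cR].
have cS0 : {within `[- T, T], continuous (fun t : R => S (t, 0))}.
  apply: continuous_in_subspaceT => t /set_mem tT.
  apply: (@continuous_comp _ _ _ (fun t : R => (t, 0 : 'rV[R]_nu.-2)) S); last exact: cS.
  exact: continuous_pairr.
have TT : - T <= T by rewrite /T; lra.
have [t0 t0T hmin] := EVT_min TT cS0.
have S0 : 0 < S (t0, 0).
  by rewrite /S/= aE; apply: (slope0_gt0 nue a0 prep); rewrite in_itv/= in t0T.
exists M, (S (t0, 0) / 2); split; [by []|by rewrite divr_gt0|].
have tube : \forall u \near (0 : 'rV[R]_nu.-2), forall t, `[- T, T]%classic t ->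
    - S (t, u) < - (S (t0, 0) / 2).
  apply: (@compact_tube R R 'rV[R]_nu.-2 `[- T, T]%classic (fun tu => - S tu)) => //.
    by move=> t tT; apply: cvgN; exact: cS.
  by move=> t tT; rewrite ltrN2; have := hmin t tT; lra.
near=> u => t tT; split.
  by move: t tT; near: u; apply: filterS hM => u h t tT; apply: h; rewrite /= in_itv.
apply: ltW; rewrite -ltrN2; move: t tT; near: u; apply: filterS tube => u h t tT.
by apply: (h t); rewrite /= in_itv.
Unshelve. all: by end_near. Qed.

Lemma acoef_lipschitz : exists L d : R, [/\ 0 < L, 0 < d &
  forall u : 'rV[R]_nu.-2, (forall j, `|u 0 j| <= d) ->
    `|acoef p u - a| <= L * \sum_j `|u 0 j|].
Proof.
have [[_ _ _ P0] [[_ Ca _ _ _] [_ aE _ _]]] := prep.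
have [Q [oQ sub C]] := smooth_on_class 1 Ca.
have [L [d [L0 d0 h]]] :=
  class_C_lipschitz (fun j : 'I_nu.-2 => delta_mx 0 j : 'rV[R]_nu.-2) oQ (sub _ P0) C.
exists L, d; split => // u hu; have := h (u 0) hu.
by rewrite add0r -row_sum_delta aE.
Qed.

(** The factor gB multiplies (I - Phi)_+ in dI/ds, and its value at 0 is the leading
mismatch; this bound turns it into a constant up to O(r) inside the window. *)
Lemma leading_lipschitz : exists L d : R, [/\ 0 < L, 0 < d &
  forall (u : 'rV[R]_nu.-2) (t y : R), (forall j, `|u 0 j| <= d) ->
    `|t| <= d -> `|y| <= d ->
    `|gfac p ((t, y), u) * Bcomp p ((t, y), u) - gfac p 0 * Bcomp p 0| <=
      L * (`|t| + `|y| + \sum_j `|u 0 j|)].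
Proof.
have [[T0 I0 _ P0] [[Cg _ _ _ CB] _]] := prep.
have [Og [oOg subg Cg1]] := smooth_on_class 1 Cg.
have [OB [oOB subB CB1]] := smooth_on_class 1 CB.
pose O := Og `&` OB.
have oO : open O by exact: openI.
have C : class_C 1 O (gfac p \* Bcomp p).
  by apply: class_CM => //; [apply: class_C_sub Cg1|apply: class_C_sub CB1] => x [].
have O0 : O 0.
  have : (box p `*` params p) (0 : R * R * 'rV[R]_nu.-2).
    by split => //; split => /=; rewrite ?oppr_le0 ?oppr_lt0 ?T0 ?I0 ?(ltW T0).
  by split; [exact: subg|exact: subB].
(* Canonical basis: the directions of t, of I and of the coordinates of u. *)
pose e (i : bool + 'I_nu.-2) : R * R * 'rV[R]_nu.-2 :=
  match i with
  | inl true => ((1, 0), 0)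
  | inl false => ((0, 1), 0)
  | inr j => ((0, 0), delta_mx 0 j)
  end.
have [L [d [L0 d0 h]]] := class_C_lipschitz e oO O0 C.
exists L, d; split => // u t y hu ht hy.
pose cf (i : bool + 'I_nu.-2) : R :=
  match i with inl true => t | inl false => y | inr j => u 0 j end.
have := h cf; rewrite add0r !big_sumType !big_bool /=.
have -> : t *: ((1, 0), 0) + y *: ((0, 1), 0) +
    \sum_j u 0 j *: ((0, 0), delta_mx 0 j) = ((t, y), u) :> R * R * 'rV[R]_nu.-2.
  have tripleE (x z : R * R * 'rV[R]_nu.-2) :
    x.1.1 = z.1.1 -> x.1.2 = z.1.2 -> x.2 = z.2 -> x = z.
    by case: x z => [[x1 x2] x3] [[z1 z2] z3] /= -> -> ->.
  have -> : \sum_j u 0 j *: ((0, 0), delta_mx 0 j) = ((0, 0), u) :> R * R * 'rV[R]_nu.-2.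
    rewrite [in RHS](row_sum_delta u).
    elim/big_rec2 : _ => [//|i y1 y2 _ ->].
    by apply: tripleE; rewrite /= -?[_ *: 0]/(_ * 0) ?mulr0 ?addr0.
  apply: tripleE; rewrite /= -?[_ *: 0]/(_ * 0) -?[_ *: 1]/(_ * 1) ?mulr1 ?mulr0 ?addr0 ?add0r//.
  by rewrite !scaler0 !add0r.
by move=> h1; apply: h1 => -[[]|j]; [exact: ht|exact: hy|exact: hu].
Qed.

Lemma uniform_bounds_exist : exists M c d L : R, uniform_bounds p a M c d L.
Proof.
have [[T0 I0 oP P0] [[Cg Ca CR CA CB] [gpos aE _ _]]] := prep.
have [Mg Mg0 hg] := smooth_on_bound Cg.
have [MA MA0 hA] := smooth_on_bound CA.
have [MB MB0 hB] := smooth_on_bound CB.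
have [MR [c [MR0 c0 hR]]] := remainder_bound.
have [La [da [La0 da0 ha]]] := acoef_lipschitz.
have [Lg [dg [Lg0 dg0 hL]]] := leading_lipschitz.
have hP : \forall u \near (0 : 'rV[R]_nu.-2), params p u by exact: open_nbhs_nbhs.
have [d d0 hd] := rV_nbhs_coord (filterI hP (filterI hg (filterI hA (filterI hB hR)))).
pose dd := Num.min d (Num.min da dg).
have [ddd dda ddg] : [/\ dd <= d, dd <= da & dd <= dg].
  by rewrite /dd; split; rewrite !ge_min lexx ?orbT.
exists (Mg + MA + MB + MR), c, dd, (La + Lg); split => //.
- by rewrite !addr_gt0.
- by rewrite !lt_min d0 da0 dg0.
- by rewrite addr_gt0.
move=> u hu; have S0 : 0 <= \sum_j `|u 0 j| by rewrite sumr_ge0.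
have [j|Pu [gu [Au [Bu Ru]]]] := hd u.
  by rewrite mxE subr0; exact: le_trans (hu j) ddd.
split => //.
- move=> z z1 z2; have zb : half_box z by split; rewrite /= in_itv/=.
  have g0 : 0 < gfac p (z, u) by apply: gpos => //; exact: half_box_sub.
  have := gu z zb; rewrite (gtr0_norm g0) => hgu.
  have hAu := Au z zb; have hBu := Bu z zb.
  by split; [exact: g0|lra|lra|lra].
- by move=> t tT; have [h1 h2] := Ru t tT; split; [lra|exact: h2].
- apply: le_trans (ha u _) _; first by move=> j; exact: le_trans (hu j) dda.
  by rewrite ler_wpM2r// lerDl ltW.
- move=> t y ht hy; apply: le_trans (hL u t y _ _ _) _.
  + by move=> j; exact: le_trans (hu j) ddg.
  + exact: le_trans ht ddg.
  + exact: le_trans hy ddg.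
  + by rewrite ler_wpM2r ?lerDr ?(ltW La0)// !addr_ge0.
Qed.
End Bounds.

(** * Barriers built on the arctangent *)

Lemma is_derive_atan_scaled (R : realType) (t : R -> R) (r s dt : R) : 0 < r ->
  is_derive s 1 t dt ->
  is_derive s 1 (fun s => r * atan (t s / r)) (dt / (1 + (t s / r) ^+ 2)).
Proof.
move=> r0 dts.
have h1 : is_derive s 1 (fun s => t s / r) (dt / r).
  have -> : (fun s => t s / r) = r^-1 \*: t.
    by apply/funext => x; rewrite /= mulrC.
  by rewrite mulrC; exact: is_deriveZ.
have h2 := @is_derive1_comp R atan (fun s : R => t s / r) s _ _ (is_derive1_atan _) h1.
have := is_deriveZ r h2; rewrite -[_ *: _]/(_ * _).
suff -> : r * ((1 + (t s / r) ^+ 2)^-1 * (dt / r)) = dt / (1 + (t s / r) ^+ 2) by [].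
by rewrite mulrCA [r * _]mulrC divfK ?gt_eqF// mulrC.
Qed.

Lemma atan_bounds (R : realType) (r x : R) : 0 < r ->
  0 <= r * atan x + r * (pi / 2) <= r * pi.
Proof.
move=> r0; have := atan_gtNpi2 x; have := atan_ltpi2 x => h1 h2.
by rewrite -mulrDr; apply/andP; split; [rewrite mulr_ge0//|rewrite ler_wpM2l//]; lra.
Qed.

(** The weight exp (-2 lam (t + T)) absorbs the term lam J since dt/ds >= 1/2, and
2 lam kap r atan(t/r) absorbs the source term.  Putting the position t rather
than the time s in the weight makes the bound independent of the duration. *)
Lemma passage_gronwall (R : realType) (t J dt dJ : R -> R) (T lam kap r c : R) :
  0 <= c -> 0 < lam -> 0 <= kap -> 0 < r ->
  {within `[0, c], continuous t} -> {within `[0, c], continuous J} ->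
  J 0 = 0 -> (forall s : R, 0 <= s <= c -> - T <= t s <= T) ->
  (forall s : R, 0 < s < c -> [/\ is_derive s 1 t (dt s), is_derive s 1 J (dJ s),
     1 / 2 <= dt s &
     0 < J s -> dJ s <= lam * (J s + kap / (1 + (t s / r) ^+ 2))]) ->
  J c <= 2 * lam * pi * expR (4 * lam * T) * kap * r.
Proof.
move=> c0 lam0 kap0 r0 ct cJ J0 tT dtJ.
have lk0 : 0 <= 2 * lam * kap by rewrite mulr_ge0// mulr_ge0// ltW.
(* w J - 2 lam kap (r atan(t/r) + r pi/2) is nonpositive initially and
   decreases where it is positive; the constant r pi/2 makes the arctangent
   term nonnegative, so that J > 0 where D > 0. *)
pose w s := expR (- (2 * lam) * (t s + T)).
pose D s := w s * J s - 2 * lam * kap * (r * atan (t s / r) + r * (pi / 2)).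
have cw : {within `[0, c], continuous w}.
  move=> s; apply: continuous_cvg; first exact: continuous_expR.
  by apply: cvgM; [exact: cvg_cst|apply: cvgD; [exact: ct|exact: cvg_cst]].
have cD : {within `[0, c], continuous D}.
  move=> s; apply: cvgB; first by apply: cvgM; [exact: cw|exact: cJ].
  apply: cvgM; first exact: cvg_cst.
  apply: cvgD; last exact: cvg_cst.
  apply: cvgM; first exact: cvg_cst.
  apply: continuous_cvg; first exact: continuous_atan.
  by apply: cvgM; [exact: ct|exact: cvg_cst].
have D0 : D c <= 0.
  apply: (@barrier_le0 R D 0 c) => //.
    rewrite /D J0 mulr0 sub0r oppr_le0 mulr_ge0//.
    by have /andP[] := atan_bounds (t 0 / r) r0.
  move=> s sc Ds0; have [dts dJs dt12 dJle] := dtJ s sc.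
  have at0 := atan_bounds (t s / r) r0.
  have ws0 : 0 < w s by rewrite expR_gt0.
  have Js0 : 0 < J s.
    move: Ds0; rewrite /D subr_gt0 -(pmulr_rgt0 _ ws0) => /(le_lt_trans _); apply.
    by rewrite mulr_ge0//; case/andP: at0.
  have dw : is_derive s 1 w (w s * (- (2 * lam) * dt s)).
    apply: (@is_derive1_comp _ expR (fun s => - (2 * lam) * (t s + T))).
    have h := is_deriveD dts (is_derive_cst T s 1).
    have := is_deriveZ (- (2 * lam)) h.
    by rewrite addr0.
  have dat := is_derive_atan_scaled r0 dts.
  exists (w s * dJ s + J s * (w s * (- (2 * lam) * dt s)) -
      2 * lam * kap * (dt s / (1 + (t s / r) ^+ 2))).
    have hB := is_deriveZ (2 * lam * kap) (is_deriveD dat (is_derive_cst (r * (pi / 2)) s 1)).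
    rewrite addr0 in hB.
    exact: (is_deriveB (is_deriveM dw dJs) hB).
  have w1 : w s <= 1.
    rewrite -expR0 ler_expR; have /andP[Tt _] : - T <= t s <= T.
      by apply: tT; case/andP: sc => ? ?; rewrite !ltW.
    by nra.
  set P := (1 + (t s / r) ^+ 2)^-1.
  have P0 : 0 <= P by rewrite invr_ge0 addr_ge0// sqr_ge0.
  have := dJle Js0; rewrite -/P => dJ'.
  have -> : w s * dJ s + J s * (w s * (- (2 * lam) * dt s)) - 2 * lam * kap * (dt s * P)
    = w s * (dJ s - 2 * lam * dt s * J s) - 2 * lam * dt s * (kap * P) by ring.
  have kP : 0 <= kap * P by rewrite mulr_ge0.
  have h1 : dJ s - 2 * lam * dt s * J s <= lam * (kap * P).
    have : lam * J s <= 2 * lam * dt s * J s by rewrite ler_wpM2r ?(ltW Js0)//; nra.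
    by move: dJ'; nra.
  have h2 : lam * (kap * P) <= 2 * lam * dt s * (kap * P) by rewrite ler_wpM2r//; nra.
  have h3 : w s * (dJ s - 2 * lam * dt s * J s) <= w s * (lam * (kap * P)) by rewrite ler_wpM2l// ltW.
  have h4 : w s * (lam * (kap * P)) <= lam * (kap * P) by rewrite ler_piMl// mulr_ge0// ltW.
  by lra.
have := atan_bounds (t c / r) r0 => /andP[_ h].
have wc : w c * J c <= 2 * lam * kap * (r * pi).
  move: D0; rewrite /D subr_le0 => /le_trans; apply.
  by rewrite ler_wpM2l.
have [J0'|J0'] := leP (J c) 0.
  by apply: le_trans J0' _; rewrite !mulr_ge0 ?expR_ge0 ?pi_ge0 ?(ltW r0) ?(ltW lam0).
have wlow : expR (- (4 * lam * T)) <= w c.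
  rewrite ler_expR; have /andP[_ tcT] : - T <= t c <= T by apply: tT; rewrite c0 lexx.
  by nra.
have : expR (- (4 * lam * T)) * J c <= 2 * lam * kap * (r * pi).
  by apply: le_trans wc; rewrite ler_wpM2r// ltW.
rewrite expRN ler_pdivrMl ?expR_gt0// => /le_trans; apply.
by rewrite le_eqVlt; apply/orP; left; apply/eqP; ring.
Qed.

(** Both D and -D decrease after subtraction of 2 kap r atan(t/r). *)
Lemma passage_drift (R : realType) (t D dt dD : R -> R) (kap r c : R) :
  0 <= c -> 0 <= kap -> 0 < r ->
  {within `[0, c], continuous t} -> {within `[0, c], continuous D} ->
  (forall s : R, 0 < s < c -> [/\ is_derive s 1 t (dt s), is_derive s 1 D (dD s),
     1 / 2 <= dt s & `|dD s| <= kap / (1 + (t s / r) ^+ 2)]) ->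
  `|D c - D 0| <= 2 * kap * pi * r.
Proof.
move=> c0 kap0 r0 ct cD dtD.
have one (G dG : R -> R) : {within `[0, c], continuous G} ->
    (forall s : R, 0 < s < c -> is_derive s 1 G (dG s) /\
       dG s <= kap / (1 + (t s / r) ^+ 2)) -> G c - G 0 <= 2 * kap * pi * r.
  move=> cG dGs; pose E s := G s - 2 * kap * (r * atan (t s / r)).
  have cE : {within `[0, c], continuous E}.
    move=> s; apply: cvgB; first exact: cG.
    apply: cvgM; first exact: cvg_cst.
    apply: cvgM; first exact: cvg_cst.
    apply: continuous_cvg; first exact: continuous_atan.
    by apply: cvgM; [exact: ct|exact: cvg_cst].
  have : E c <= E 0.
    apply: derive_le0_le => // s sc; have [dts _ dt12 _] := dtD s sc.
    have [dGG dGle] := dGs s sc.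
    exists (dG s - 2 * kap * (dt s / (1 + (t s / r) ^+ 2))).
      exact: (is_deriveB dGG (is_deriveZ (2 * kap) (is_derive_atan_scaled r0 dts))).
    have kP : 0 <= kap / (1 + (t s / r) ^+ 2) by rewrite divr_ge0// addr_ge0// sqr_ge0.
    rewrite subr_le0; apply: le_trans dGle _.
    have -> : 2 * kap * (dt s / (1 + (t s / r) ^+ 2)) = 2 * dt s * (kap / (1 + (t s / r) ^+ 2)) by ring.
    by rewrite ler_peMl//; lra.
  rewrite /E; have := atan_bounds (t c / r) r0; have := atan_bounds (t 0 / r) r0.
  move=> /andP[a1 a2] /andP[a3 a4]; nra.
rewrite ler_norml; apply/andP; split; last first.
  by apply: (one D dD) => // s /dtD[_ ? _]; rewrite ler_norml => /andP[].
suff : - D c - - D 0 <= 2 * kap * pi * r by lra.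
apply: (one (fun s => - D s) (fun s => - dD s)).
  by move=> s; apply: cvgN; exact: cD.
move=> s /dtD[_ dDs _]; rewrite ler_norml => /andP[h _]; split; first exact: is_deriveN.
by rewrite lerNl.
Qed.

(** * The rescaled profile and its integral *)

Section Profile.
Context {R : realType} {nu : nat}.
Hypothesis nu2 : (2 <= nu)%N.
Implicit Types (u : 'rV[R]_nu.-2) (x : R).
Local Notation m := (nu.-2).

Let nuE : nu = m.+2. Proof. by case: nu nu2 => [|[]]. Qed.

(** Weighted homogeneity: u_j t^j has weight (nu - j) + j = nu. *)
Lemma unfolding_rescale r u t : r != 0 ->
  unfolding (rescale r u) t = r ^+ nu * unfolding u (t / r).
Proof.
move=> r0; rewrite /unfolding mulr_sumr; apply: eq_bigr => j _.
have jn : (j.+1 <= nu)%N by apply: leq_trans (ltn_ord j) _; rewrite -subn2 leq_subr.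
have -> : r ^+ nu = r ^+ (nu - j.+1) * r ^+ j.+1 by rewrite -exprD subnK.
rewrite mxE expr_div_n; move: (j.+1) => k.
by field; rewrite expf_neq0.
Qed.

Lemma unfolding_bound u x (N Y : R) : 0 <= N -> 1 <= Y -> `|x| <= Y ->
  (forall j, `|u 0 j| <= N) -> `|unfolding u x| <= m%:R * N * Y ^+ m.
Proof.
move=> N0 Y1 xY uN; apply: le_trans (ler_norm_sum _ _ _) _.
have h (j : 'I_m) : `|u 0 j * x ^+ j.+1| <= N * Y ^+ m.
  rewrite normrM normrX ler_pM// ?exprn_ge0//.
  apply: (@le_trans _ _ (Y ^+ j.+1)); first by rewrite lerXn2r// nnegrE (le_trans _ Y1).
  by rewrite ler_weXn2l.
apply: le_trans (ler_sum _ (fun j _ => h j)) _.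
by rewrite sumr_const card_ord -[X in X <= _]mulr_natl mulrA.
Qed.

(** Beyond this radius c |x|^nu dominates y + |sum_j u_j x^j| as soon as |u_j| <= N. *)
Definition active_radius (c N y : R) : R := 1 + (y + m%:R * N) / c.

Definition active_height (c N y : R) : R := y + m%:R * N * active_radius c N y ^+ m.

Section Active.
Variables (c N y : R).
Hypotheses (c0 : 0 < c) (N0 : 0 <= N) (y0 : 0 <= y) (nue : ~~ odd nu).
Let X := active_radius c N y.
Let H := active_height c N y.

Let mN0 : 0 <= m%:R * N. Proof. by rewrite mulr_ge0. Qed.

Lemma active_radius_ge1 : 1 <= X.
Proof. by rewrite /X /active_radius lerDl divr_ge0 ?addr_ge0// ltW. Qed.

Lemma active_height_ge0 : 0 <= H.
Proof.
rewrite addr_ge0// mulr_ge0// exprn_ge0//; apply: le_trans active_radius_ge1.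
exact: ler01.
Qed.

(** For |x| >= 1 all lower order terms are at most (y + m N) |x|^m, m = nu - 2, while
c |x|^nu >= c |x| |x|^m. *)
Lemma inactive u S z x : (forall j, `|u 0 j| <= N) -> c <= S -> z <= y ->
  X <= `|x| -> z - S * x ^+ nu - unfolding u x <= 0.
Proof.
move=> uN cS zy Xx.
have x1 : 1 <= `|x| by exact: le_trans active_radius_ge1 Xx.
have x0 : 0 <= `|x| by exact: normr_ge0.
have xm : 1 <= `|x| ^+ m by rewrite exprn_ege1.
have := unfolding_bound N0 x1 (lexx _) uN; rewrite ler_norml => /andP[h1 _].
have xnu : x ^+ nu = `|x| ^+ m * `|x| ^+ 2.
  rewrite -exprD addn2 -nuE -normrX ger0_norm// exprn_even_ge0//.
have h2 : y + m%:R * N <= c * `|x|.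
  have : (y + m%:R * N) / c <= `|x| by apply: le_trans Xx; rewrite /X /active_radius lerDr.
  by rewrite ler_pdivrMr// [X in _ <= X]mulrC.
have h3 : y <= y * `|x| ^+ m by rewrite ler_peMr.
have h4 : (y + m%:R * N) * `|x| ^+ m <= c * `|x| * `|x| ^+ m by rewrite ler_wpM2r// exprn_ge0.
have h5 : c * `|x| * `|x| ^+ m <= S * x ^+ nu.
  have h6 : c * `|x| <= S * `|x| ^+ 2.
    apply: ler_pM => //; first exact: ltW.
    by rewrite expr2 ler_peMr.
  rewrite xnu [X in _ <= _ * X]mulrC mulrA.
  by rewrite ler_wpM2r// exprn_ge0.
by move: h4; rewrite mulrDl; lra.
Qed.

Lemma active_le u S z x : (forall j, `|u 0 j| <= N) -> c <= S -> z <= y ->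
  `|x| <= X -> z - S * x ^+ nu - unfolding u x <= H.
Proof.
move=> uN cS zy xX.
have := unfolding_bound N0 active_radius_ge1 xX uN; rewrite ler_norml => /andP[h1 _].
have h2 : 0 <= S * x ^+ nu.
  by rewrite mulr_ge0 ?exprn_even_ge0// (le_trans _ cS)// ltW.
by rewrite /H /active_height -/X; lra.
Qed.

(** The value is at most H where it is nonzero, and 1 + x^2 <= 1 + X^2 there. *)
Lemma active_bound u S z x : (forall j, `|u 0 j| <= N) -> c <= S -> z <= y ->
  Num.max (z - S * x ^+ nu - unfolding u x) 0 <= H * (1 + X ^+ 2) / (1 + x ^+ 2).
Proof.
move=> uN cS zy; have H0 := active_height_ge0.
have p x' : 0 < 1 + x' ^+ 2 :> R by rewrite ltr_pwDl// sqr_ge0.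
have r0 : 0 <= H * (1 + X ^+ 2) / (1 + x ^+ 2) by rewrite divr_ge0 ?mulr_ge0// ltW.
rewrite ge_max r0 andbT; have [xX|/ltW Xx] := leP `|x| X; last first.
  exact: le_trans (inactive uN cS zy Xx) r0.
apply: le_trans (active_le uN cS zy xX) _.
rewrite ler_pdivlMr// ler_wpM2l// lerD2l -[x ^+ 2]real_normK ?num_real//.
by rewrite lerXn2r// nnegrE// (le_trans _ active_radius_ge1).
Qed.
End Active.

(** The integrand of the cap vanishes outside [-L, L], so the increment of an
antiderivative over that interval is the integral over the whole line. *)
Lemma cap_antiderivative (a c rho N y L : R) u : 0 < c -> c <= a -> 0 <= N ->
  0 <= y -> ~~ odd nu -> (forall j, `|u 0 j| <= N) -> rho <= y ->
  active_radius c N y <= L ->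
  exists Gam : R -> R,
    (forall x, - L - 1 < x ->
       is_derive x 1 Gam (Num.max (rho - a * x ^+ nu - unfolding u x) 0)) /\
    Gam L - Gam (- L) = cap a rho u.
Proof.
move=> c0 ca N0 y0 nue uN rhoy XL.
pose f (x : R) : R := Num.max (rho - a * x ^+ nu - unfolding u x) 0.
have L1 : 1 <= L by apply: le_trans XL; exact: active_radius_ge1.
have f0 x : L <= `|x| -> f x = 0.
  move=> Lx; apply/max_idPr; apply: (inactive c0 N0 y0 nue uN ca rhoy).
  exact: le_trans XL Lx.
have cf : continuous f.
  move=> x; apply: (@continuous_comp _ _ _ (fun x : R => rho - a * x ^+ nu - unfolding u x)
    (fun z : R => Num.max z 0)); last exact: continuous_max0.
  apply: cvgB; last first.
    apply: cvg_big => [|j _]; first exact: add_continuous.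
    by apply: cvgM; [exact: cvg_cst|exact: exprn_continuous].
  apply: cvgB; first exact: cvg_cst.
  by apply: cvgM; [exact: cvg_cst|exact: exprn_continuous].
exists (fun x => \int[@lebesgue_measure R]_(t in `[- L - 1, x]) f t); split.
  by move=> x Lx; exact: continuous_antiderivative.
have -> : \int[@lebesgue_measure R]_(t in `[- L - 1, - L]) f t = 0.
  rewrite (@eq_Rintegral _ _ _ _ _ (cst 0)) ?Rintegral_cst ?mul0r//.
  move=> x; rewrite inE/= in_itv/= => /andP[_ xL].
  by apply: f0; rewrite ler_normr; apply/orP; right; lra.
rewrite subr0 /cap -/f Rintegral_mkcond; congr Rintegral.
apply/funext => x; rewrite patchE; case: ifPn => // /negP h; apply/esym/f0.
have [Lx|xL] := leP L `|x|; first by [].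
exfalso; apply: h; rewrite inE/= in_itv/=; move: xL; rewrite ltr_norml.
by move=> /andP[]; lra.
Qed.
End Profile.

(** * Curves in the plane *)

Lemma cvg_is_derive (R : realType) (V : normedModType R) (f : R -> V) (s : R) (d : V) :
  is_derive s 1 f d <-> h^-1 *: ((f \o shift s) (h *: 1) - f s) @[h --> 0^'] --> d.
Proof.
split=> [[df <-]|fd]; first exact: df.
by split; [apply/cvg_ex; exists d|exact: cvg_lim fd].
Qed.

(** A limit in a product is a pair of limits, applied to difference quotients. *)
Lemma is_derive_pairP (R : realType) (f : R -> R * R) (s : R) (d : R * R) :
  is_derive s 1 f d <->
  is_derive s 1 (fun s => (f s).1) d.1 /\ is_derive s 1 (fun s => (f s).2) d.2.
Proof.
split=> [/cvg_is_derive fd|[/cvg_is_derive d1 /cvg_is_derive d2]].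
  split; apply/cvg_is_derive.
    by apply: (cvg_comp _ _ fd (@cvg_fst _ _ _ _ _)).
  by apply: (cvg_comp _ _ fd (@cvg_snd _ _ _ _ _)).
apply/cvg_is_derive; rewrite [d]surjective_pairing.
exact: (cvg_pair d1 d2).
Qed.

Lemma within_fst (R : realType) (A : set R) (f : R -> R * R) :
  {within A, continuous f} -> {within A, continuous (fun s => (f s).1)}.
Proof. by move=> cf s; apply: (cvg_comp _ _ (cf s) (@cvg_fst _ _ _ _ _)). Qed.

Lemma within_snd (R : realType) (A : set R) (f : R -> R * R) :
  {within A, continuous f} -> {within A, continuous (fun s => (f s).2)}.
Proof. by move=> cf s; apply: (cvg_comp _ _ (cf s) (@cvg_snd _ _ _ _ _)). Qed.

(** * Clamping and bounded Lipschitz functions *)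

Lemma maxr_lipschitz (R : realType) (k x z : R) :
  `|Num.max x k - Num.max z k| <= `|x - z|.
Proof.
wlog xz : x z / z <= x.
  by move=> h; have [/h//|/ltW/h] := leP z x; rewrite distrC [X in _ <= X]distrC.
rewrite !ger0_norm ?subr_ge0//; last by rewrite ge_max !le_max lexx xz orbT.
by have [x0|x0] := leP x k; have [z0|z0] := leP z k; lra.
Qed.

Lemma minr_lipschitz (R : realType) (k x z : R) :
  `|Num.min x k - Num.min z k| <= `|x - z|.
Proof.
have minE (y : R) : Num.min y k = - Num.max (- y) (- k) by rewrite oppr_max !opprK.
rewrite !minE -opprD normrN; apply: le_trans (maxr_lipschitz _ _ _) _.
by rewrite -opprD normrN.
Qed.

Definition clamp (R : realType) (lo hi x : R) : R := Num.max lo (Num.min x hi).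

Lemma clamp_itv (R : realType) (lo hi x : R) : lo <= hi -> lo <= clamp lo hi x <= hi.
Proof. by move=> lh; rewrite /clamp le_max lexx ge_max lh ge_min lexx orbT. Qed.

Lemma clamp_id (R : realType) (lo hi x : R) : lo <= x <= hi -> clamp lo hi x = x.
Proof. by move=> /andP[lx xh]; rewrite /clamp (min_idPl xh) (max_idPr lx). Qed.

Lemma clamp_lipschitz (R : realType) (lo hi x z : R) :
  `|clamp lo hi x - clamp lo hi z| <= `|x - z|.
Proof.
rewrite /clamp ![Num.max lo _]maxC; apply: le_trans (maxr_lipschitz _ _ _) _.
exact: minr_lipschitz.
Qed.

(** Boundedness is included because it is what makes the class stable under
products. *)
Definition bounded_lipschitz (R : realType) (F : R -> R -> R) : Prop :=
  exists L : R, [/\ 0 <= L, forall x y, `|F x y| <= L &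
    forall x y x' y', `|F x y - F x' y'| <= L * (`|x - x'| + `|y - y'|)].

Section BoundedLipschitz.
Context {R : realType}.
Implicit Types F G : R -> R -> R.

Lemma bounded_lipschitz_cst (k : R) : bounded_lipschitz (fun _ _ => k).
Proof.
exists `|k|; split => // x y x' y'; rewrite subrr normr0.
by rewrite mulr_ge0// addr_ge0.
Qed.

Lemma bounded_lipschitzD F G : bounded_lipschitz F -> bounded_lipschitz G ->
  bounded_lipschitz (fun x y => F x y + G x y).
Proof.
move=> [A [A0 FA FL]] [B [B0 GB GL]]; exists (A + B); split; first exact: addr_ge0.
  by move=> x y; apply: le_trans (ler_normD _ _) (lerD _ _).
move=> x y x' y'; rewrite mulrDl opprD addrACA.
exact: le_trans (ler_normD _ _) (lerD _ _).
Qed.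

Lemma bounded_lipschitzM F G : bounded_lipschitz F -> bounded_lipschitz G ->
  bounded_lipschitz (fun x y => F x y * G x y).
Proof.
move=> [A [A0 FA FL]] [B [B0 GB GL]]; exists (A * B + (A * B + A * B)).
have AB : 0 <= A * B by exact: mulr_ge0.
have FG x y : `|F x y * G x y| <= A * B by rewrite normrM; exact: ler_pM.
split; first by rewrite !addr_ge0.
  by move=> x y; apply: le_trans (FG x y) _; rewrite lerDl addr_ge0.
move=> x y x' y'; have -> : F x y * G x y - F x' y' * G x' y' =
  F x y * (G x y - G x' y') + (F x y - F x' y') * G x' y' by ring.
set e : R := `|x - x'| + `|y - y'|.
have e0 : 0 <= e by rewrite addr_ge0.
apply: (@le_trans _ _ ((A * B + A * B) * e)).
  rewrite [X in _ <= X]mulrDl; apply: le_trans (ler_normD _ _) _; rewrite !normrM; apply: lerD.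
    by rewrite -mulrA; exact: ler_pM.
  by rewrite mulrAC; exact: ler_pM.
by rewrite ler_wpM2r// lerDr.
Qed.

Lemma bounded_lipschitz_max0 F : bounded_lipschitz F ->
  bounded_lipschitz (fun x y => Num.max (F x y) 0).
Proof.
move=> [A [A0 FA FL]]; exists A; split => // x y.
  by rewrite ger0_norm ?le_max ?lexx ?orbT// ge_max A0 andbT; exact: le_trans (ler_norm _) _.
by move=> x' y'; exact: le_trans (maxr_lipschitz _ _ _) _.
Qed.

Lemma bounded_lipschitzX F n : bounded_lipschitz F ->
  bounded_lipschitz (fun x y => F x y ^+ n).
Proof.
move=> bF; elim: n => [|n IH]; first exact: bounded_lipschitz_cst.
have -> : (fun x y => F x y ^+ n.+1) = (fun x y => F x y * F x y ^+ n).
  by apply/funext => x; apply/funext => y; rewrite exprS.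
exact: bounded_lipschitzM.
Qed.

Lemma bounded_lipschitz_sum n (F : 'I_n -> R -> R -> R) :
  (forall i, bounded_lipschitz (F i)) ->
  bounded_lipschitz (fun x y => \sum_i F i x y).
Proof.
elim: n F => [|n IH] F bF.
  have -> : (fun x y => \sum_(i < 0) F i x y) = (fun _ _ => 0).
    by apply/funext => x; apply/funext => y; rewrite big_ord0.
  exact: bounded_lipschitz_cst.
have -> : (fun x y => \sum_i F i x y) =
    (fun x y => \sum_(i < n) F (widen_ord (leqnSn n) i) x y + F ord_max x y).
  by apply/funext => x; apply/funext => y; rewrite big_ord_recr.
by apply: bounded_lipschitzD; [exact: IH|exact: bF].
Qed.

Lemma bounded_lipschitz_clamp1 (lo hi : R) : lo <= hi ->
  bounded_lipschitz (fun x y => clamp lo hi x).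
Proof.
move=> lh; exists (1 + (`|lo| + `|hi|)); split; first by rewrite !addr_ge0.
  move=> x y; have /andP[h1 h2] := clamp_itv x lh.
  have := ler_norm hi; have := ler_norm (- lo); rewrite normrN ler_norml => h3 h4.
  by have := normr_ge0 lo; have := normr_ge0 hi => h5 h6; apply/andP; split; lra.
move=> x y x' y'; apply: le_trans (clamp_lipschitz _ _ _ _) _.
apply: (@le_trans _ _ (1 * (`|x - x'| + `|y - y'|))); first by rewrite mul1r lerDl.
by rewrite ler_wpM2r ?addr_ge0// lerDl addr_ge0.
Qed.

Lemma bounded_lipschitz_clamp2 (lo hi : R) : lo <= hi ->
  bounded_lipschitz (fun x y => clamp lo hi y).
Proof.
move=> lh; have [A [A0 FA FL]] := bounded_lipschitz_clamp1 lh.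
exists A; split => // [x y|x y x' y']; first exact: FA y x.
by apply: le_trans (FL y x y' x') _; rewrite addrC.
Qed.

(** The rectangle spanned by e1 and e2 is compact and convex, so the mean value
inequality applies to a move along e1 followed by a move along e2. *)
Lemma class_C_bounded_lipschitz (V : normedModType R) (O : set V) (f : V -> R)
    (x0 e1 e2 : V) (lo1 hi1 lo2 hi2 : R) : lo1 <= hi1 -> lo2 <= hi2 ->
  class_C 1 O f ->
  (forall x y, lo1 <= x <= hi1 -> lo2 <= y <= hi2 -> O (x0 + x *: e1 + y *: e2)) ->
  bounded_lipschitz (fun x y => f (x0 + clamp lo1 hi1 x *: e1 + clamp lo2 hi2 y *: e2)).
Proof.
move=> lh1 lh2 Cf Orect.
pose par (z : R * R) : V := x0 + z.1 *: e1 + z.2 *: e2.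
pose K := par @` (`[lo1, hi1] `*` `[lo2, hi2]).
have cpar : continuous par.
  move=> z; apply: cvgD; last by apply: cvgZr_tmp; exact: cvg_snd.
  by apply: cvgD; [exact: cvg_cst|apply: cvgZr_tmp; exact: cvg_fst].
have cK : compact K.
  apply: continuous_compact; first by exact: continuous_subspaceT.
  by apply: compact_setX; exact: segment_compact.
have KP x y : lo1 <= x <= hi1 -> lo2 <= y <= hi2 -> K (x0 + x *: e1 + y *: e2).
  by move=> hx hy; exists (x, y) => //; split; rewrite /= in_itv.
have KO : K `<=` O.
  move=> _ [[x y] [/= + +] <-]; rewrite !in_itv/=; exact: Orect.
have [A A0 hA] := compact_bound cK (fun x Kx => Cf.1 x (KO x Kx)).
have [L1 L10 hL1] := compact_directional_lipschitz e1 cK KO Cf.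
have [L2 L20 hL2] := compact_directional_lipschitz e2 cK KO Cf.
have conv (lo hi x x' s : R) : lo <= x <= hi -> lo <= x' <= hi -> 0 <= s <= 1 ->
    lo <= x' + s * (x - x') <= hi.
  by move=> /andP[a1 a2] /andP[a3 a4] /andP[a5 a6]; apply/andP; split; nra.
exists (A + L1 + L2); split; first by rewrite !addr_ge0 ?ltW.
  move=> x y; apply: (@le_trans _ _ A); last by lra.
  by apply: hA; apply: KP; exact: clamp_itv.
move=> x y x' y'; set X := clamp lo1 hi1 x; set X' := clamp lo1 hi1 x'.
set Y := clamp lo2 hi2 y; set Y' := clamp lo2 hi2 y'.
have hX : lo1 <= X <= hi1 by exact: clamp_itv.
have hX' : lo1 <= X' <= hi1 by exact: clamp_itv.
have hY : lo2 <= Y <= hi2 by exact: clamp_itv.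
have hY' : lo2 <= Y' <= hi2 by exact: clamp_itv.
have dX : `|X - X'| <= `|x - x'| by exact: clamp_lipschitz.
have dY : `|Y - Y'| <= `|y - y'| by exact: clamp_lipschitz.
have step1 : `|f (x0 + X *: e1 + Y *: e2) - f (x0 + X' *: e1 + Y *: e2)| <= L1 * `|X - X'|.
  have := hL1 (x0 + X' *: e1 + Y *: e2) (X - X').
  have E (s : R) : x0 + X' *: e1 + Y *: e2 + (s * (X - X')) *: e1 =
      x0 + (X' + s * (X - X')) *: e1 + Y *: e2.
    by rewrite scalerDl addrAC -!addrA.
  have := E 1; rewrite !mul1r [X' + (X - X')]addrC subrK => -> h; apply: h => s s01.
  by rewrite E; apply: KP => //; exact: conv.
have step2 : `|f (x0 + X' *: e1 + Y *: e2) - f (x0 + X' *: e1 + Y' *: e2)| <= L2 * `|Y - Y'|.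
  have := hL2 (x0 + X' *: e1 + Y' *: e2) (Y - Y').
  have E (s : R) : x0 + X' *: e1 + Y' *: e2 + (s * (Y - Y')) *: e2 =
      x0 + X' *: e1 + (Y' + s * (Y - Y')) *: e2.
    by rewrite scalerDl -!addrA.
  have := E 1; rewrite !mul1r [Y' + (Y - Y')]addrC subrK => -> h; apply: h => s s01.
  by rewrite E; apply: KP => //; exact: conv.
rewrite -[X in `|X|](subrKA (f (x0 + X' *: e1 + Y *: e2))).
apply: le_trans (ler_normD _ _) _; apply: le_trans (lerD step1 step2) _.
have := ler_wpM2l (ltW L10) dX; have := ler_wpM2l (ltW L20) dY.
move: (normr_ge0 (x - x')) (normr_ge0 (y - y')); nra.
Qed.
End BoundedLipschitz.

(** * Asymptotics of the passage *)

Section Estimate.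
Context {R : realType} {nu : nat} (p : passage R nu) (a M c d L N : R).
Hypothesis nu2 : (2 <= nu)%N.
Hypothesis nue : ~~ odd nu.
Hypothesis T0 : 0 < halfT p.
Hypothesis I0 : 0 < Istar p.
Hypothesis bounds : uniform_bounds p a M c d L.
Hypothesis N0 : 0 < N.
Local Notation T := (halfT p).
Local Notation m := (nu.-2).

Let X := active_radius (nu := nu) c N (N + 1).
Let H := active_height (nu := nu) c N (N + 1).
Let beta := gfac p 0 * Bcomp p 0.

(** The factor K such that (I - Phi)_+ <= r^nu K / (1 + (t/r)^2). *)
Definition majorant_const : R := H * (1 + X ^+ 2).

(** Half-width of the strip |I| <= b used for confinement.  The last bound makes
|h_+ A| <= 1/2 there, so that the motion advances in t at speed at least 1/2. *)
Definition inner_width : R :=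
  Num.min (Num.min (Istar p / 2) d) (1 / (4 * M ^+ 2)).

Definition deviation_const : R :=
  2 * M ^+ 2 * pi * expR (4 * M ^+ 2 * T) * majorant_const.

(** Dividing by the sum of all the constants involved turns each smallness condition
on r into a consequence of this single one. *)
Definition threshold : R :=
  Num.min (Num.min 1 inner_width) T /
  (1 + N + 1 + majorant_const + deviation_const + X).

Let K1 := majorant_const.
Let b := inner_width.
Let C2 := deviation_const.

Let M0 : 0 < M. Proof. by case: bounds. Qed.
Let c0 : 0 < c. Proof. by case: bounds. Qed.
Let d0 : 0 < d. Proof. by case: bounds. Qed.
Let L0 : 0 < L. Proof. by case: bounds. Qed.
Let y0 : 0 <= N + 1. Proof. by rewrite addr_ge0// ltW. Qed.
Let X1 : 1 <= X. Proof. exact: active_radius_ge1 (ltW N0) y0. Qed.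
Let H0 : 0 <= H. Proof. exact: active_height_ge0 c0 (ltW N0) y0. Qed.
Let K10 : 0 <= K1. Proof. by rewrite /K1 /majorant_const mulr_ge0// addr_ge0// sqr_ge0. Qed.
Let C20 : 0 <= C2.
Proof.
rewrite /C2 /deviation_const -/K1; apply: mulr_ge0 K10.
apply: mulr_ge0 (expR_ge0 _); apply: mulr_ge0 (pi_ge0 _).
by apply: mulr_ge0 (sqr_ge0 _).
Qed.
Let b0 : 0 < b.
Proof. by rewrite /b /inner_width !lt_min d0 divr_gt0//= divr_gt0// mulr_gt0// exprn_gt0. Qed.
Let bI : b <= Istar p / 2. Proof. by rewrite /b /inner_width !ge_min lexx. Qed.
Let strip w : - b <= w <= b -> - (Istar p / 2) <= w <= Istar p / 2.
Proof. by have := bI; move=> h /andP[h1 h2]; apply/andP; split; lra. Qed.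
Let bd : b <= d. Proof. by rewrite /b /inner_width !ge_min lexx orbT. Qed.
Let bM : M ^+ 2 * (2 * b) <= 1 / 2.
Proof.
have M2 : 0 < 4 * M ^+ 2 by rewrite mulr_gt0// exprn_gt0.
have : b <= 1 / (4 * M ^+ 2) by rewrite /b /inner_width !ge_min lexx !orbT.
by rewrite ler_pdivlMr//; lra.
Qed.

Let den0 : 0 < 1 + N + 1 + majorant_const + deviation_const + X.
Proof. by move: K10 C20 X1 N0; rewrite /K1 /C2; lra. Qed.

Lemma threshold_gt0 : 0 < threshold.
Proof.
have b0' : 0 < inner_width by exact: b0.
by rewrite divr_gt0 ?den0// lt_min T0 lt_min ltr01 b0'.
Qed.

Variables (r rho : R) (u : 'rV[R]_m).
Hypothesis r0 : 0 < r.
Hypothesis rsmall : r < threshold.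
Hypothesis rhoN : `|rho| <= N.
Hypothesis uN : forall j, `|u 0 j| <= N.
Let v := rescale r u.
Let q := r ^+ nu * rho.

Let small :
  [/\ r <= 1, r * N + r * C2 < b, r * N + r * K1 < b, r * (N + 1) < b & r * X < T]
  /\ (r * X < b /\ r * C2 <= 1).
Proof.
(* All the products below are nonnegative summands of r times the denominator. *)
have aux (K C Y B : R) : 0 <= K -> 0 <= C -> 1 <= Y ->
    r * (1 + N + 1 + K + C + Y) < Num.min (Num.min 1 B) T ->
    [/\ r <= 1, r * N + r * C < B, r * N + r * K < B, r * (N + 1) < B & r * Y < T]
    /\ (r * Y < B /\ r * C <= 1).
  move=> K0' C0' Y1'.
  have rN : 0 <= r * N by rewrite mulr_ge0// ltW.
  have rK : 0 <= r * K by rewrite mulr_ge0// ltW.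
  have rC : 0 <= r * C by rewrite mulr_ge0// ltW.
  have rY : 0 <= r * Y by rewrite mulr_ge0 ?ltW// (lt_le_trans ltr01).
  rewrite !lt_min !mulrDr mulr1.
  have r0' := r0; have N0' := N0.
  move=> /andP[/andP[h1 h2] h3]; split; last by split; lra.
  split; [lra|lra|lra|lra|lra].
apply: aux K10 C20 X1 _; have := rsmall.
by rewrite /threshold ltr_pdivlMr ?den0.
Qed.

Let r1 : r <= 1. Proof. by case: small => -[]. Qed.
Let rn_r : r ^+ nu <= r.
Proof.
rewrite -[X in _ <= X]expr1; apply: ler_wiXn2l => //; first exact: ltW.
exact: ltnW.
Qed.
Let rn0 : 0 < r ^+ nu. Proof. by rewrite exprn_gt0. Qed.

Let vN j : `|v 0 j| <= r * N.
Proof.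
rewrite mxE normrM normrX (gtr0_norm r0) ler_pM ?exprn_ge0 ?(ltW r0)//.
rewrite -[X in _ <= X]expr1; apply: ler_wiXn2l => //; first exact: ltW.
have : (j < nu - 2)%N by rewrite subn2.
by rewrite ltn_subRL subn_gt0 => /ltnW.
Qed.

Let vd j : `|v 0 j| <= d.
Proof.
apply: le_trans (vN j) _; apply: le_trans bd; apply: ltW.
by case: small => -[] _ _; have := mulr_ge0 (ltW r0) K10; lra.
Qed.

Let at_v := (let: And5 _ _ _ _ h := bounds in h) v vd.

Let qN : `|q| <= r ^+ nu * N.
Proof. by rewrite normrM (gtr0_norm rn0) ler_wpM2l// ltW. Qed.

Let q_le : q <= r ^+ nu * (N + 1).
Proof. by rewrite ler_wpM2l ?(ltW rn0)//; have := ler_norm rho; have := rhoN; lra. Qed.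

Let slope (t : R) := acoef p v + t * remainder p (t, v).

Lemma PhiE t : Phi p v t = r ^+ nu * (slope t * (t / r) ^+ nu + unfolding u (t / r)).
Proof.
rewrite /Phi unfolding_rescale ?gt_eqF// mulrDr -/v /slope.
have -> : t ^+ nu = r ^+ nu * (t / r) ^+ nu by rewrite expr_div_n mulrC divfK// gt_eqF.
by rewrite exprS (_ : t ^+ nu = r ^+ nu * (t / r) ^+ nu); [ring|rewrite expr_div_n mulrC divfK// gt_eqF].
Qed.

Lemma gap_scaled t w : w - Phi p v t =
  r ^+ nu * (w / r ^+ nu - slope t * (t / r) ^+ nu - unfolding u (t / r)).
Proof.
rewrite PhiE; have : r ^+ nu != 0 by rewrite gt_eqF.
by move: (r ^+ nu) => x x0; field.
Qed.

Lemma max_scaled (x : R) : Num.max (r ^+ nu * x) 0 = r ^+ nu * Num.max x 0.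
Proof. by rewrite maxr_pMr ?ltW// mulr0. Qed.

(** This is [active_bound] at x = t/r, after extraction of the factor r^nu. *)
Lemma gap_bound t w : - T <= t <= T -> w <= r ^+ nu * (N + 1) ->
  Num.max (w - Phi p v t) 0 <= r ^+ nu * K1 / (1 + (t / r) ^+ 2).
Proof.
move=> tT wle; rewrite gap_scaled max_scaled -mulrA ler_wpM2l ?(ltW rn0)//.
have [_ _ /(_ t tT)[_ cS] _ _] := at_v.
apply: active_bound => //; first exact: ltW.
by rewrite ler_pdivrMr// mulrC.
Qed.

Lemma gap_bound_const t w : - T <= t <= T -> w <= r ^+ nu * (N + 1) ->
  Num.max (w - Phi p v t) 0 <= r ^+ nu * K1.
Proof.
move=> tT wle; apply: le_trans (gap_bound tT wle) _.
have rk : 0 <= r ^+ nu * K1 by apply: mulr_ge0 K10; exact: ltW.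
by rewrite ler_pdivrMr ?ltr_pwDl ?sqr_ge0// ler_peMr// lerDl sqr_ge0.
Qed.

Let act (z : R * R) := Num.max (switching p v z) 0.

Lemma activation z : - T <= z.1 <= T -> - b <= z.2 <= b ->
  act z = gfac p (z, v) * Num.max (z.2 - Phi p v z.1) 0.
Proof.
move=> z1 /strip z2; have [_ /(_ z z1 z2)[]] := at_v.
by move=> g0 _ _ _ _ _ _; rewrite /act /switching maxr_pMr ?ltW// mulr0.
Qed.

(** The third bound feeds [passage_gronwall]: (w - Phi)_+ exceeds (q - Phi)_+ by at
most |w - q|. *)
Lemma field_bounds t w : - T <= t <= T -> - b <= w <= b ->
  let psi : R := Num.max (w - Phi p v t) 0 in
  [/\ `|act (t, w) * Acomp p ((t, w), v)| <= M ^+ 2 * psi,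
      `|act (t, w) * Bcomp p ((t, w), v)| <= M ^+ 2 * psi,
      psi <= `|w - q| + r ^+ nu * K1 / (1 + (t / r) ^+ 2) &
      M ^+ 2 * psi <= 1 / 2].
Proof.
move=> tT wb psi.
have psi0 : 0 <= psi by rewrite /psi le_max lexx orbT.
have [_ /(_ (t, w) tT (strip wb))[]] := at_v.
move=> g0 gM AM BM _ _ _.
rewrite activation//= -/psi.
have pq : psi <= `|w - q| + Num.max (q - Phi p v t) 0.
  rewrite /psi ge_max; apply/andP; split; last by rewrite addr_ge0// le_max lexx orbT.
  have : q - Phi p v t <= Num.max (q - Phi p v t) 0 by rewrite le_max lexx.
  by have := ler_norm (w - q); lra.
have gpsi (x : R) : `|x| <= M -> `|gfac p ((t, w), v) * psi * x| <= M ^+ 2 * psi.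
  move=> xM; rewrite !normrM (gtr0_norm g0) (ger0_norm psi0) mulrAC expr2.
  by rewrite ler_wpM2r// ler_pM// ltW.
split; [exact: gpsi|exact: gpsi| |].
  by apply: le_trans pq _; rewrite lerD2l; apply: gap_bound.
apply: le_trans bM; rewrite ler_wpM2l ?sqr_ge0//.
apply: le_trans pq _; have := gap_bound_const tT q_le.
have [[_ _ h _ _] _] := small.
have h1 : `|w - q| <= b + r ^+ nu * N.
  apply: le_trans (ler_normB _ _) _; rewrite lerD//; first by rewrite ler_norml.
have h2 : r ^+ nu * N <= r * N by rewrite ler_wpM2r// ltW.
have h3 : r ^+ nu * K1 <= r * K1 by rewrite ler_wpM2r.
by lra.
Qed.

(** The field is evaluated at (t, w) and not at (t, y): with w = y this covers actual
trajectories, and with w the clamped y the auxiliary ones used for existence. *)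
Lemma deviation (t y w : R -> R) (s1 : R) : 0 <= s1 ->
  {within `[0, s1], continuous t} -> {within `[0, s1], continuous y} ->
  y 0 = q -> (forall s : R, 0 <= s <= s1 -> - T <= t s <= T) ->
  (forall s : R, 0 < s < s1 -> [/\ - b <= w s <= b, `|w s - q| <= `|y s - q|,
     is_derive s 1 t (1 + act (t s, w s) * Acomp p ((t s, w s), v)) &
     is_derive s 1 y (act (t s, w s) * Bcomp p ((t s, w s), v))]) ->
  `|y s1 - q| <= C2 * r ^+ nu * r.
Proof.
move=> s10 ct cy yq tT dyn.
have M20 : 0 < M ^+ 2 by rewrite exprn_gt0.
have rk : 0 <= r ^+ nu * K1 by apply: mulr_ge0 K10; exact: ltW.
have CE : C2 * r ^+ nu * r = 2 * M ^+ 2 * pi * expR (4 * M ^+ 2 * T) * (r ^+ nu * K1) * r.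
  by rewrite /C2 /deviation_const -/K1; ring.
pose dt s := 1 + act (t s, w s) * Acomp p ((t s, w s), v).
pose dy s := act (t s, w s) * Bcomp p ((t s, w s), v).
have one (J dJ : R -> R) : {within `[0, s1], continuous J} -> J 0 = 0 ->
    (forall s : R, 0 < s < s1 -> is_derive s 1 J (dJ s) /\ `|dJ s| = `|dy s|) ->
    (forall s : R, `|J s| = `|y s - q|) -> J s1 <= C2 * r ^+ nu * r.
  move=> cJ J0 dJs Jy; rewrite CE.
  apply: (@passage_gronwall R t J dt dJ) => // s ss.
  have [wb wq ts ys] := dyn s ss.
  have tsT : - T <= t s <= T by apply: tT; case/andP: ss => h1 h2; rewrite !ltW.
  have [hA hB hpsi half] := field_bounds tsT wb.
  have [dJ1 dJ2] := dJs s ss.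
  split => //; first by move: hA half; rewrite /dt ler_norml => /andP[]; lra.
  move=> J0s; apply: le_trans (ler_norm _) _; rewrite dJ2.
  apply: le_trans hB _; rewrite ler_wpM2l ?(ltW M20)//.
  apply: le_trans hpsi _; rewrite lerD2r; apply: le_trans wq _.
  by rewrite -Jy gtr0_norm.
rewrite ler_norml; apply/andP; split; last first.
  apply: (one (fun s => y s - q) dy).
  - by move=> s; apply: cvgB; [exact: cy|exact: cvg_cst].
  - by rewrite yq subrr.
  - move=> s ss; split => //; have [_ _ _ ys] := dyn s ss.
    by rewrite -[dy s]subr0; exact: (is_deriveB ys (is_derive_cst q s 1)).
  - by [].
suff : q - y s1 <= C2 * r ^+ nu * r by lra.
apply: (one (fun s => q - y s) (fun s => - dy s)).
- by move=> s; apply: cvgB; [exact: cvg_cst|exact: cy].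
- by rewrite yq subrr.
- move=> s ss; split; last by rewrite normrN.
  have [_ _ _ ys] := dyn s ss.
  by rewrite -[- dy s]add0r; exact: (is_deriveB (is_derive_cst q s 1) ys).
- by move=> s; rewrite distrC.
Qed.

Let dev_le1 : C2 * r ^+ nu * r <= r ^+ nu.
Proof.
have [_ [_ h]] := small; rewrite mulrAC [C2 * r]mulrC.
by rewrite -[X in _ <= X]mul1r ler_wpM2r// ltW.
Qed.

Let dev_lt : `|q| + C2 * r ^+ nu * r < b.
Proof.
have [[_ h _ _ _] _] := small; apply: le_lt_trans h; apply: lerD.
  by apply: le_trans qN _; rewrite ler_wpM2r// ltW.
rewrite mulrAC [C2 * r]mulrC ler_piMr//; first exact: mulr_ge0 (ltW r0) C20.
exact: le_trans rn_r r1.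
Qed.

Let near_q y : `|y - q| <= C2 * r ^+ nu * r ->
  [/\ - b < y < b, `|y| <= r ^+ nu * (N + 1) & y <= r ^+ nu * (N + 1)].
Proof.
move=> yq; have h : `|y| <= `|q| + C2 * r ^+ nu * r.
  have -> : y = q + (y - q) by rewrite addrC subrK.
  by apply: le_trans (ler_normD _ _) _; rewrite lerD2l.
have h2 : `|y| <= r ^+ nu * (N + 1).
  by apply: le_trans h _; rewrite mulrDr mulr1 lerD.
split => //; first by rewrite -ltr_norml; exact: le_lt_trans h dev_lt.
exact: le_trans (ler_norm _) h2.
Qed.

Let c_le_a : c <= a.
Proof.
have [_ _ _ _ /(_ 0)[]] := bounds; first by move=> j; rewrite mxE normr0 ltW.
move=> _ _ /(_ 0)[]; first by have := T0; move=> h; apply/andP; split; lra.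
move=> _ + + _; rewrite mul0r addr0 big1; last by move=> j _; rewrite mxE normr0.
by rewrite mulr0 normr_le0 subr_eq0 => h /eqP <-.
Qed.

(** The three terms bound, up to the factor r^(nu+1), the errors made in replacing gB
by beta, (I - Phi)_+ by the rescaled profile, and dt/ds by 1. *)
Definition rate_const : R :=
  L * (X + (N + 1) + m%:R * N) * H +
  `|beta| * (C2 + (L * (m%:R * N) + M * X) * X ^+ nu) +
  `|beta| * (H * (M ^+ 2 * H)).

Let profile x := Num.max (rho - a * x ^+ nu - unfolding u x) 0.

Let rho_le : rho <= N + 1.
Proof. by have := ler_norm rho; have := rhoN; lra. Qed.

Let sumv : \sum_j `|v 0 j| <= r * (m%:R * N).
Proof.
apply: le_trans (ler_sum _ (fun j _ => vN j)) _.
by rewrite sumr_const card_ord -[X in X <= _]mulr_natl mulrCA.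
Qed.

Let rate_ge0 : 0 <= rate_const.
Proof.
have X0 : 0 <= X by exact: le_trans ler01 X1.
have mN : 0 <= m%:R * N by apply: mulr_ge0 => //; exact: ltW.
have LX : 0 <= X + (N + 1) + m%:R * N by apply: addr_ge0 => //; exact: addr_ge0.
rewrite /rate_const; apply: addr_ge0; first apply: addr_ge0.
- by apply: mulr_ge0 => //; apply: mulr_ge0 => //; exact: ltW.
- apply: mulr_ge0 => //; apply: addr_ge0 => //.
  apply: mulr_ge0; last exact: exprn_ge0.
  by apply: addr_ge0; apply: mulr_ge0 => //; exact: ltW.
- apply: mulr_ge0 => //; apply: mulr_ge0 => //; apply: mulr_ge0 => //.
  exact: sqr_ge0.
Qed.

(** Outside the window both rates vanish; inside, gB, (I - Phi)_+ and dt/ds are replaced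
one after the other by beta, r^nu times the profile, and 1. *)
Lemma rate_error t y : - T <= t <= T -> `|y - q| <= C2 * r ^+ nu * r ->
  `|act (t, y) * Bcomp p ((t, y), v) - beta * (r ^+ nu * profile (t / r)) *
      (1 + act (t, y) * Acomp p ((t, y), v))|
  <= r ^+ nu * r * rate_const * (1 + X ^+ 2) / (1 + (t / r) ^+ 2).
Proof.
move=> tT yq; have [yb yabs yle] := near_q yq.
have {}yb : - b <= y <= b by case/andP: yb => h1 h2; rewrite !ltW.
set x := t / r.
have tE : t = r * x by rewrite /x mulrC divfK// gt_eqF.
have [_ /(_ (t, y) tT (strip yb))[g0 gM AM BM] /(_ t tT)[RM cS] av gB] := at_v.
set psi := Num.max (y - Phi p v t) 0.
have psi0 : 0 <= psi by rewrite /psi le_max lexx orbT.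
have [hA _ _ _] := field_bounds tT yb.
have psiE : psi = r ^+ nu * Num.max (y / r ^+ nu - slope t * x ^+ nu - unfolding u x) 0.
  by rewrite /psi gap_scaled max_scaled.
have yr : y / r ^+ nu <= N + 1 by rewrite ler_pdivrMr// mulrC.
have p0 : 0 < 1 + x ^+ 2 by rewrite ltr_pwDl// sqr_ge0.
have X0 : 0 <= X by exact: le_trans ler01 X1.
have mN : 0 <= m%:R * N by apply: mulr_ge0 => //; exact: ltW.
have rr0 : 0 <= r ^+ nu * r * rate_const.
  by apply: mulr_ge0 rate_ge0; apply: mulr_ge0; exact: ltW.
rewrite activation//= -/psi.
(* Outside the window both rates are zero. *)
have [Xx|xX] := leP X `|x|.
  have -> : psi = 0.
    have E : y / r ^+ nu - slope t * x ^+ nu - unfolding u x <= 0.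
      exact: (inactive nu2 c0 (ltW N0) y0 nue uN cS yr Xx).
    by rewrite psiE (max_idPr E) mulr0.
  have -> : profile x = 0.
    by apply/max_idPr; exact: (inactive nu2 c0 (ltW N0) y0 nue uN c_le_a rho_le Xx).
  rewrite !mulr0 !mul0r subrr normr0; apply: divr_ge0; last exact: ltW.
  by apply: mulr_ge0 => //; rewrite addr_ge0// sqr_ge0.
apply: (@le_trans _ _ (r ^+ nu * r * rate_const)); last first.
  rewrite ler_pdivlMr// ler_wpM2l// lerD2l -[x ^+ 2]real_normK ?num_real//.
  by apply: lerXn2r; rewrite ?nnegrE// ltW.
have {}xX : `|x| <= X by exact: ltW.
set P1 := Num.max (y / r ^+ nu - slope t * x ^+ nu - unfolding u x) 0 in psiE.
have P1_ge0 : 0 <= P1 by rewrite /P1 le_max lexx orbT.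
have P1_le : P1 <= H.
  by rewrite /P1 ge_max H0 andbT; exact: (active_le c0 (ltW N0) y0 nue uN cS yr xX).
have P0_ge0 : 0 <= profile x by rewrite /profile le_max lexx orbT.
have P0_le : profile x <= H.
  by rewrite /profile ge_max H0 andbT; exact: (active_le c0 (ltW N0) y0 nue uN c_le_a rho_le xX).
have tr : `|t| <= r * X by rewrite tE normrM (gtr0_norm r0) ler_wpM2l// ltW.
have yrN : `|y| <= r * (N + 1) by apply: le_trans yabs _; rewrite ler_wpM2r.
(* The three error terms collected in [rate_const]. *)
have lead : `|gfac p ((t, y), v) * Bcomp p ((t, y), v) - beta| <=
    r * (L * (X + (N + 1) + m%:R * N)).
  have [[_ _ _ h1 _] [h2 _]] := small.
  apply: le_trans (gB t y _ _) _.
  - by apply: le_trans tr _; apply: le_trans bd; exact: ltW.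
  - by apply: le_trans yrN _; apply: le_trans bd; exact: ltW.
  - rewrite mulrCA ler_wpM2l ?(ltW L0)//.
    by apply: le_trans (lerD (lerD tr yrN) sumv) _; rewrite !mulrDr.
have diff : `|P1 - profile x| <= r * (C2 + (L * (m%:R * N) + M * X) * X ^+ nu).
  apply: le_trans (maxr_lipschitz _ _ _) _.
  have -> : y / r ^+ nu - slope t * x ^+ nu - unfolding u x - (rho - a * x ^+ nu - unfolding u x)
     = (y - q) / r ^+ nu - (slope t - a) * x ^+ nu.
    rewrite /q; have : r ^+ nu != 0 by rewrite gt_eqF.
    by move: (r ^+ nu) => z z0; field.
  apply: le_trans (ler_normB _ _) _; rewrite mulrDr; apply: lerD.
    rewrite normrM normfV (gtr0_norm rn0) ler_pdivrMr//.
    by apply: le_trans yq _; rewrite le_eqVlt; apply/orP; left; apply/eqP; ring.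
  rewrite normrM mulrA; apply: ler_pM => //; last by rewrite normrX; apply: lerXn2r; rewrite ?nnegrE.
  have -> : slope t - a = (acoef p v - a) + t * remainder p (t, v) by rewrite /slope addrAC.
  apply: le_trans (ler_normD _ _) _; rewrite mulrDr; apply: lerD.
    apply: le_trans av _; rewrite mulrCA; apply: ler_wpM2l; first exact: ltW.
    exact: sumv.
  have -> : r * (M * X) = (r * X) * M by ring.
  by rewrite normrM; apply: ler_pM.
have actA : `|gfac p ((t, y), v) * psi * Acomp p ((t, y), v)| <= r * (M ^+ 2 * H).
  move: hA; rewrite activation//= -/psi => /le_trans; apply.
  rewrite mulrCA; apply: ler_wpM2l; first exact: sqr_ge0.
  by rewrite psiE; apply: ler_pM => //; exact: ltW.
have -> : gfac p ((t, y), v) * psi * Bcomp p ((t, y), v) -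
    beta * (r ^+ nu * profile x) * (1 + gfac p ((t, y), v) * psi * Acomp p ((t, y), v)) =
    r ^+ nu * ((gfac p ((t, y), v) * Bcomp p ((t, y), v) - beta) * P1 + beta * (P1 - profile x)
     - beta * (profile x * (gfac p ((t, y), v) * psi * Acomp p ((t, y), v)))).
  by rewrite psiE; ring.
rewrite normrM (gtr0_norm rn0) -[X in _ <= X]mulrA; apply: ler_wpM2l; first exact: ltW.
have -> : r * rate_const = r * (L * (X + (N + 1) + m%:R * N)) * H +
    `|beta| * (r * (C2 + (L * (m%:R * N) + M * X) * X ^+ nu)) +
    `|beta| * (H * (r * (M ^+ 2 * H))) by rewrite /rate_const; ring.
apply: le_trans (ler_normB _ _) _; apply: lerD.
  apply: le_trans (ler_normD _ _) _; rewrite !normrM; apply: lerD.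
    by rewrite (ger0_norm P1_ge0); apply: ler_pM.
  by apply: ler_wpM2l.
rewrite normrM; apply: ler_wpM2l => //.
by rewrite normrM (ger0_norm P0_ge0); apply: ler_pM.
Qed.

(** The function y - beta r^(nu+1) Gam(t/r), with Gam an antiderivative of the
profile, has the derivative estimated in [rate_error]. *)
Lemma leading_order (t y : R -> R) (s1 : R) : 0 <= s1 ->
  {within `[0, s1], continuous t} -> {within `[0, s1], continuous y} ->
  y 0 = q -> t 0 = - T -> t s1 = T ->
  (forall s : R, 0 <= s <= s1 -> - T <= t s <= T) ->
  (forall s : R, 0 < s < s1 -> [/\ `|y s - q| <= C2 * r ^+ nu * r,
     is_derive s 1 t (1 + act (t s, y s) * Acomp p ((t s, y s), v)) &
     is_derive s 1 y (act (t s, y s) * Bcomp p ((t s, y s), v))]) ->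
  `|y s1 - q - beta * r ^+ nu.+1 * cap a rho u| <=
    2 * (rate_const * (1 + X ^+ 2)) * pi * r ^+ nu.+2.
Proof.
move=> s10 ct cy yq t0 t1 tT dyn.
have XT : X <= T / r.
  by rewrite ler_pdivlMr// mulrC ltW//; case: small => -[].
have [Gam [dGam GamE]] :=
  cap_antiderivative nu2 c0 c_le_a (ltW N0) y0 nue uN rho_le XT.
pose dt s := 1 + act (t s, y s) * Acomp p ((t s, y s), v).
pose dy s := act (t s, y s) * Bcomp p ((t s, y s), v).
pose D s := y s - beta * (r ^+ nu * r) * Gam (t s / r).
have tr s : - T <= t s <= T -> - (T / r) - 1 < t s / r.
  move=> /andP[h _]; apply: (@lt_le_trans _ _ (- (T / r))); first by lra.
  by rewrite -mulNr ler_wpM2r// invr_ge0 ltW.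
have cD : {within `[0, s1], continuous D}.
  have ctr : {within `[0, s1], continuous (fun s => t s / r)}.
    by move=> s; apply: cvgM; [exact: ct|exact: cvg_cst].
  have cG : {within `[0, s1], continuous (fun s => Gam (t s / r))}.
    apply/subspace_continuousP => s ss.
    have cGs : {for t s / r, continuous Gam}.
      apply: is_derive_continuous (dGam _ _); apply: tr; apply: tT.
      by move: ss; rewrite /= in_itv.
    exact: (cvg_comp _ _ ((subspace_continuousP _ _).1 ctr s ss) cGs).
  move=> s; apply: cvgB; first exact: cy.
  by apply: cvgM; [exact: cvg_cst|exact: cG].
have kap0 : 0 <= r ^+ nu * r * rate_const * (1 + X ^+ 2).
  apply: mulr_ge0; last by rewrite addr_ge0// sqr_ge0.
  by apply: mulr_ge0 rate_ge0; apply: mulr_ge0; exact: ltW.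
have := @passage_drift R t D dt (fun s => dy s - beta * (r ^+ nu * profile (t s / r)) * dt s)
   (r ^+ nu * r * rate_const * (1 + X ^+ 2)) r s1 s10 kap0 r0 ct cD.
rewrite /D yq t0 t1 mulNr => drift.
have -> : y s1 - q - beta * r ^+ nu.+1 * cap a rho u =
  y s1 - beta * (r ^+ nu * r) * Gam (T / r) - (q - beta * (r ^+ nu * r) * Gam (- (T / r))).
  by rewrite -GamE exprSr; ring.
have -> : 2 * (rate_const * (1 + X ^+ 2)) * pi * r ^+ nu.+2 =
  2 * (r ^+ nu * r * rate_const * (1 + X ^+ 2)) * pi * r.
  by rewrite !exprSr; ring.
apply: drift => s ss; have [yqs dts dys] := dyn s ss.
have tsT : - T <= t s <= T by apply: tT; case/andP: ss => h1 h2; rewrite !ltW.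
have [ysb _ _] := near_q yqs.
have ysb' : - b <= y s <= b by case/andP: ysb => h1 h2; rewrite !ltW.
split; first exact: dts.
- have dtr : is_derive s 1 (fun s => t s / r) (dt s / r).
    have -> : (fun s => t s / r) = r^-1 \*: t.
      by apply/funext => z; rewrite /= mulrC.
    by rewrite mulrC; exact: is_deriveZ.
  have dG := @is_derive1_comp R Gam (fun s => t s / r) s _ _ (dGam _ (tr _ tsT)) dtr.
  have h := is_deriveB dys (is_deriveZ (beta * (r ^+ nu * r)) dG).
  suff <- : (beta * (r ^+ nu * r)) *: (profile (t s / r) * (dt s / r)) =
    beta * (r ^+ nu * profile (t s / r)) * dt s by exact: h.
  rewrite -[_ *: _]/(_ * _).
  by move: (r ^+ nu) (profile _) (dt s) => z1 z2 z3; field; rewrite gt_eqF.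
- have [hA _ _ half] := field_bounds tsT ysb'.
  by move: hA half; rewrite /dt ler_norml => /andP[]; lra.
- exact: rate_error.
Qed.

(** At the first time when |I| reaches b the motion has stayed in the strip, so the
deviation bound applies up to that time and gives |I| < b: the exit never occurs. *)
Lemma transit_leading_order (tau : R) (gamma : R -> R * R) :
  transit p (Xphys p v) q tau gamma ->
  `|(gamma tau).2 - q - beta * r ^+ nu.+1 * cap a rho u| <=
    2 * (rate_const * (1 + X ^+ 2)) * pi * r ^+ nu.+2.
Proof.
move=> [[tau0 g0 cg] [dg gbox glt gtau]].
have ct := within_fst cg; have cy := within_snd cg.
set t := fun s => (gamma s).1 in ct; set y := fun s => (gamma s).2 in cy.
have dyn s : 0 < s < tau ->
    is_derive s 1 t (1 + act (t s, y s) * Acomp p ((t s, y s), v)) /\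
    is_derive s 1 y (act (t s, y s) * Bcomp p ((t s, y s), v)).
  move=> /dg /is_derive_pairP; rewrite /Xphys/= add0r.
  by rewrite -[_ *: _]/(_ * _) -[_ *: _]/(_ * _) /t /y -!surjective_pairing.
have tT s : 0 <= s <= tau -> - T <= t s <= T by move=> /gbox[].
have y0q : y 0 = q by rewrite /y g0.
have sub s : s <= tau -> `[0, s] `<=` `[0, tau].
  by move=> st; apply: subset_itvl; rewrite bnd_simp.
have dev s : 0 <= s <= tau -> (forall s' : R, 0 < s' < s -> `|y s'| < b) ->
    `|y s - q| <= C2 * r ^+ nu * r.
  move=> /andP[s0 st] conf.
  apply: (@deviation t y y s s0 (continuous_subspaceW (sub s st) ct)
    (continuous_subspaceW (sub s st) cy) y0q).
    by move=> s' /andP[h1 h2]; apply: tT; rewrite h1 (le_trans h2).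
  move=> s' /[dup] ss' /andP[h1 h2]; have := conf s' ss'.
  have [] := dyn s'; first by rewrite h1 (lt_le_trans h2).
  move=> h3 h4; rewrite ltr_norml => /andP[h5 h6]; split => //.
  by rewrite !ltW.
(* First exit from the strip. *)
have confined s : 0 <= s <= tau -> `|y s| < b.
  move=> /andP[s0 st]; rewrite ltNge; apply/negP => bs.
  have cabs : {within `[0, s], continuous (fun s => `|y s|)}.
    move=> x; apply: cvg_norm; exact: (continuous_subspaceW (sub s st) cy).
  have q0b : `|y 0| < b.
    rewrite y0q; apply: le_lt_trans dev_lt; rewrite lerDl.
    by apply: mulr_ge0 (ltW r0); apply: mulr_ge0 C20 (ltW rn0).
  have [s' [s'0 s's ys' before]] := first_hit s0 cabs q0b bs.
  have s'tau : 0 <= s' <= tau by rewrite ltW//= (le_trans s's).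
  have h : `|y s' - q| <= C2 * r ^+ nu * r.
    apply: dev; first exact: s'tau.
    by move=> s2 /andP[h1 h2]; apply: before; rewrite ltW.
  by have [+ _ _] := near_q h; rewrite -ltr_norml ys' ltxx.
apply: (@leading_order t y tau tau0 ct cy y0q _ gtau tT).
  by rewrite /t g0.
move=> s /[dup] ss /andP[h1 h2]; have [h3 h4] := dyn s ss.
split; [|exact: h3|exact: h4].
apply: dev; first by rewrite !ltW.
by move=> s' /andP[h5 h6]; apply: confined; rewrite ltW//= ltW// (lt_trans h6).
Qed.

Let ct x := clamp (- T) T x.
Let cb x := clamp (- b) b x.

Let TT : - T <= T. Proof. by have := T0; lra. Qed.
Let bb : - b <= b. Proof. by have := b0; lra. Qed.

(** Evaluation at the clamped point makes a function smooth on the box globally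
bounded and Lipschitz. *)
Let extended_bounded_lipschitz (f : R * R * 'rV[R]_m -> R) :
  smooth_on (box p `*` params p) f ->
  bounded_lipschitz (fun x y => f ((ct x, cb y), v)).
Proof.
move=> /(smooth_on_class 1)[Q [_ sub Cf]].
have E x y : ((x, y), v) = (0, v) + x *: ((1, 0), 0) + y *: ((0, 1), 0) :> R * R * 'rV[R]_m.
  congr (_, _) => /=; last by rewrite !scaler0 !addr0.
  by congr (_, _) => /=; rewrite -?[_ *: 0]/(_ * 0) -?[_ *: 1]/(_ * 1) ?mulr1 ?mulr0 ?addr0 ?add0r.
have -> : (fun x y => f ((ct x, cb y), v)) =
   (fun x y => f ((0, v) + ct x *: ((1, 0), 0) + cb y *: ((0, 1), 0))).
  by apply/funext => x; apply/funext => y; rewrite E.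
apply: class_C_bounded_lipschitz Cf _ => // x y hx hy.
rewrite -E; apply: sub; split => /=; last by case: at_v.
by split => //=; have := strip hy; have := I0; move=> h /andP[h1 h2]; apply/andP; split; lra.
Qed.

Hypothesis prep : prepared p a.

Let act_bounded_lipschitz : bounded_lipschitz (fun x y => act (ct x, cb y)).
Proof.
have [_ [[Cg _ CR _ _] _]] := prep.
apply: bounded_lipschitz_max0; apply: bounded_lipschitzM.
  exact: extended_bounded_lipschitz Cg.
have bt : bounded_lipschitz (fun x y : R => ct x) by exact: bounded_lipschitz_clamp1.
have bR : bounded_lipschitz (fun x y : R => remainder p (ct x, v)).
  have [Q [_ sub CQ]] := smooth_on_class 1 CR.
  have E x y : (x, v) = (0, v) + x *: (1, 0) + y *: (0, 0) :> R * 'rV[R]_m.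
    congr (_, _) => /=; last by rewrite !scaler0 !addr0.
    by rewrite -?[_ *: 0]/(_ * 0) -?[_ *: 1]/(_ * 1) mulr1 mulr0 addr0 add0r.
  have -> : (fun x y : R => remainder p (ct x, v)) =
     (fun x y : R => remainder p ((0, v) + ct x *: (1, 0) + cb y *: (0, 0))).
    by apply/funext => x; apply/funext => y; rewrite -(E (ct x) (cb y)).
  apply: class_C_bounded_lipschitz CQ _ => // x y hx hy.
  rewrite -E; apply: sub; split => /=; last by case: at_v.
  by rewrite in_itv.
have bPhi : bounded_lipschitz (fun x y : R => - Phi p v (ct x)).
  have -> : (fun x y : R => - Phi p v (ct x)) = (fun x y : R => -1 *
     (acoef p v * ct x ^+ nu + (\sum_(j < m) v 0 j * ct x ^+ j.+1) +
      ct x ^+ nu.+1 * remainder p (ct x, v))).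
    by apply/funext => x; apply/funext => y; rewrite mulN1r.
  apply: bounded_lipschitzM; first exact: bounded_lipschitz_cst.
  apply: bounded_lipschitzD; last first.
    by apply: bounded_lipschitzM => //; exact: bounded_lipschitzX.
  apply: bounded_lipschitzD.
    apply: bounded_lipschitzM; first exact: bounded_lipschitz_cst.
    exact: bounded_lipschitzX.
  apply: bounded_lipschitz_sum => j.
  apply: bounded_lipschitzM; first exact: bounded_lipschitz_cst.
  exact: bounded_lipschitzX.
by apply: bounded_lipschitzD => //; exact: bounded_lipschitz_clamp2.
Qed.

(** The clamped field has dt/ds >= 1/2, so its solution reaches t = T before the time
4 T; until then it is a solution of the physical field by [deviation]. *)
Lemma transit_exists : exists (tau : R) (gamma : R -> R * R),
  transit p (Xphys p v) q tau gamma.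
Proof.
have [_ [[_ _ _ CA CB] _]] := prep.
(* Components of the physical field evaluated at the clamped point. *)
pose P1 x y := 1 + act (ct x, cb y) * Acomp p ((ct x, cb y), v).
pose P2 x y := act (ct x, cb y) * Bcomp p ((ct x, cb y), v).
have [A1 [A10 A1b A1l]] : bounded_lipschitz P1.
  apply: bounded_lipschitzD; first exact: bounded_lipschitz_cst.
  by apply: bounded_lipschitzM => //; exact: extended_bounded_lipschitz CA.
have [A2 [A20 A2b A2l]] : bounded_lipschitz P2.
  by apply: bounded_lipschitzM => //; exact: extended_bounded_lipschitz CB.
pose P (i : bool) (z : bool -> R) := if i then P1 (z true) (z false) else P2 (z true) (z false).
have Pbd i z : `|P i z| <= A1 + A2.
  by case: i; [apply: le_trans (A1b _ _) _; rewrite lerDl|apply: le_trans (A2b _ _) _; rewrite lerDr].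
have Plip i z z' : `|P i z - P i z'| <= (A1 + A2 + 1) * \sum_j `|z j - z' j|.
  rewrite big_bool /=; case: i.
    by apply: le_trans (A1l _ _ _ _) _; rewrite ler_wpM2r ?addr_ge0//; lra.
  by apply: le_trans (A2l _ _ _ _) _; rewrite ler_wpM2r ?addr_ge0//; lra.
have LL : 0 < A1 + A2 + 1 by rewrite ltr_wpDl// addr_ge0.
have [z [z0 dz]] := picard_lindelof (fun i : bool => if i then - T else q) LL Pbd Plip.
pose t s := z s true; pose y s := z s false.
have dt (s : R) : 0 <= s -> is_derive s 1 t (P1 (t s) (y s)) by move=> /(dz s true).
have dy (s : R) : 0 <= s -> is_derive s 1 y (P2 (t s) (y s)) by move=> /(dz s false).
have within0 (f : R -> R) (df : R -> R) c1 : (forall s : R, 0 <= s -> is_derive s 1 f (df s)) ->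
    {within `[0, c1], continuous f}.
  move=> dfs; apply: continuous_in_subspaceT => s /set_mem.
  by rewrite /= in_itv/= => /andP[/dfs/is_derive_continuous].
have wt c1 : {within `[0, c1], continuous t} by exact: within0 dt.
have wy c1 : {within `[0, c1], continuous y} by exact: within0 dy.
have speed x w : 1 / 2 <= P1 x w.
  have [h _ _ half] := field_bounds (clamp_itv x TT) (clamp_itv w bb).
  by move: h half; rewrite /P1 ler_norml => /andP[]; lra.
have progress (s : R) : 0 <= s -> s / 2 - T <= t s.
  move=> s0; have : s / 2 - t s <= 0 / 2 - t 0.
    apply: (@derive_le0_le _ (fun s => s / 2 - t s)) => //.
      move=> x; apply: cvgB; last exact: wt.
      by apply: cvgM; [exact: (continuous_subspaceT (fun x => @cvg_id _ (nbhs x)))|exact: cvg_cst].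
    move=> x /andP[/ltW x0 _]; exists (1 / 2 - P1 (t x) (y x)); last by have := speed (t x) (y x); lra.
    apply: is_deriveB (dt x x0).
    have -> : (fun s : R => s / 2) = 2^-1 \*: (id : R -> R).
      by apply/funext => w /=; rewrite mulrC.
    by apply: is_derive_eq; rewrite -[LHS]/(_ * _) mulr1 mul1r.
  by rewrite /t z0; lra.
(* From -T at speed at least 1/2, t = T is reached no later than s = 4 T. *)
have T40 : 0 <= 4 * T by have := T0; lra.
have t0T : t 0 < T by rewrite /t z0; have := T0; lra.
have Tt : T <= t (4 * T) by have := progress _ T40; lra.
have [tau [tau0 _ tauT before]] := first_hit T40 (wt _) t0T Tt.
have tT s : 0 <= s <= tau -> - T <= t s <= T.
  move=> /andP[s0]; rewrite le_eqVlt => /predU1P[->|st].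
    by rewrite tauT lexx TT.
  rewrite (ltW (before s _)) ?s0// andbT.
  by have := progress s s0; lra.
have dev s : 0 <= s <= tau -> `|y s - q| <= C2 * r ^+ nu * r.
  move=> /andP[s0 st].
  apply: (@deviation t y (fun s => cb (y s)) s s0 (wt _) (wy _)).
  - by rewrite /y z0.
  - by move=> s' /andP[h1 h2]; apply: tT; rewrite h1 (le_trans h2).
  move=> s' /andP[/ltW h1 /ltW h2].
  have cts : ct (t s') = t s' by apply/clamp_id/tT; rewrite h1 (le_trans h2).
  have cq : cb q = q.
    have q0 : `|q - q| <= C2 * r ^+ nu * r.
      rewrite subrr normr0; apply: mulr_ge0 (ltW r0); exact: mulr_ge0 C20 (ltW rn0).
    have [/andP[h3 h4] _ _] := near_q q0.
    by apply: clamp_id; rewrite !ltW.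
  split; first exact: clamp_itv.
  - by rewrite -{1}cq; exact: clamp_lipschitz.
  - by have := dt s' h1; rewrite /P1 cts.
  - by have := dy s' h1; rewrite /P2 cts.
have yb s : 0 <= s <= tau -> - b < y s < b by move=> /dev/near_q[].
exists tau, (fun s => (t s, y s)); split; split.
- exact: ltW.
- by rewrite /t /y !z0.
- by move=> s; exact: (cvg_pair (wt _ s) (wy _ s)).
- move=> s /andP[/ltW s0 /ltW st]; apply/is_derive_pairP.
  have ss : 0 <= s <= tau by rewrite s0.
  have cts : ct (t s) = t s by exact/clamp_id/tT.
  have cys : cb (y s) = y s.
    by apply: clamp_id; have /andP[h1 h2] := yb s ss; rewrite !ltW.
  rewrite /Xphys/= add0r -[_ *: Acomp p _]/(_ * _) -[_ *: Bcomp p _]/(_ * _).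
  split.
  + by have := dt s s0; rewrite /P1 cts cys.
  + by have := dy s s0; rewrite /P2 cts cys.
- move=> s ss; split; first exact: tT.
  by have /andP[h1 h2] := yb s ss; have := bI; have := I0; move=> h3 h4; apply/andP; split => /=; lra.
- by move=> s; exact: before.
- exact: tauT.
Qed.

Lemma launch_bound : - Istar p < q < Istar p.
Proof.
have h : `|q| < b.
  apply: le_lt_trans dev_lt; rewrite lerDl.
  by apply: mulr_ge0 (ltW r0); exact: mulr_ge0 C20 (ltW rn0).
rewrite -ltr_norml; apply: lt_le_trans h _; apply: le_trans bI _.
by have := I0; lra.
Qed.
End Estimate.

(** * The mismatch, the reference trajectory and the conclusion *)

(** If the second factor vanishes at the base point and is tangent there to the second
coordinate, continuity of the first factor suffices to differentiate the product. *)
Lemma diff_mul_vanishing (R : realType) (G F : R * R -> R) (C e : R) :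
  {for 0, continuous G} -> 0 <= C -> 0 < e ->
  (forall z, `|z| <= e -> `|F z - z.2| <= C * `|z| ^+ 2) ->
  forall v : R * R, 'd (fun z => G z * F z) (0 : R * R) v = G 0 * v.2.
Proof.
move=> cG C0 e0 Fle v.
have F0 : F 0 = 0.
  have := Fle 0; rewrite normr0 expr2 !mulr0 subr0 => /(_ (ltW e0)).
  by rewrite normr_le0 => /eqP.
have csnd : continuous (G 0 \*o @snd R R : R * R -> R).
  by move=> z; apply: cvgMl_tmp; exact: cvg_snd.
rewrite (@diff_unique R (R * R)%type R (fun z => G z * F z) (G 0 \*o @snd R R) 0 csnd)//.
apply/eqaddoP => eps eps0.
(* It suffices that G varies by less than eps/2 and that h is small against eps. *)
have near1 : \forall h \near (0 : R * R), `|G h - G 0| < eps / 2.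
  by apply: (cvgr_distC_lt _ _ cG); rewrite divr_gt0.
pose B : R := `|G 0| + eps / 2.
have B0 : 0 < B by rewrite /B ltr_wpDl// divr_gt0.
pose rad : R := Num.min e (eps / (2 * B * (C + 1))).
have rad0 : 0 < rad.
  by rewrite lt_min e0 divr_gt0// !mulr_gt0// ltr_wpDl.
have near2 : \forall h \near (0 : R * R), ball (0 : R * R) rad h by exact: nbhsx_ballx.
near=> h.
rewrite !fctE /= addr0 F0 mulr0 add0r.
have hG : `|G h - G 0| < eps / 2 by near: h.
have he : `|h| < Num.min e (eps / (2 * B * (C + 1))).
  have : ball (0 : R * R) rad h by near: h.
  by rewrite -ball_normE /= sub0r normrN.
move: he; rewrite lt_min => /andP[he1]; rewrite ltr_pdivlMr; last first.
  by rewrite !mulr_gt0// ltr_wpDl.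
move=> he2.
have h2 : `|h.2| <= `|h| by rewrite prod_normE le_max lexx orbT.
(* Error of the linear approximation: the increment of G times h.2, plus G times
   the second order remainder of F. *)
have -> : G h * F h - G 0 * h.2 = (G h - G 0) * h.2 + G h * (F h - h.2) by ring.
apply: le_trans (ler_normD _ _) _; rewrite !normrM.
have GB : `|G h| <= B.
  rewrite /B; have -> : G h = G 0 + (G h - G 0) by rewrite addrC subrK.
  by apply: le_trans (ler_normD _ _) _; rewrite lerD2l ltW.
have t1 : `|G h - G 0| * `|h.2| <= eps / 2 * `|h| by apply: ler_pM => //; exact: ltW.
have t2 : `|G h| * `|F h - h.2| <= B * (C * `|h| ^+ 2).
  by apply: ler_pM => //; apply: Fle; exact: ltW.
have t3 : B * (C * `|h| ^+ 2) <= eps / 2 * `|h|.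
  have -> : B * (C * `|h| ^+ 2) = (B * C * `|h|) * `|h| by ring.
  rewrite ler_wpM2r//.
  have : 0 <= `|h| * B by rewrite mulr_ge0// ltW.
  by move: he2; nra.
by rewrite [X in _ <= X * _]splitr mulrDl; lra.
Unshelve. all: by end_near. Qed.

Lemma mismatchE (R : realType) (nu : nat) (p : passage R nu) (a : R) :
  (2 <= nu)%N -> ~~ odd nu -> 0 < a -> prepared p a ->
  mismatch p = gfac p 0 * Bcomp p 0.
Proof.
move=> nu2 nue a0 prep; have [[T0 I0 _ P0] [[Cg _ _ _ _] [_ aE _ _]]] := prep.
have [M [c [d [L [M0 _ d0 _ /(_ 0)[]]]]]] := uniform_bounds_exist nue a0 prep.
  by move=> j; rewrite mxE normr0 ltW.
move=> _ _ hR _ _.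
have [Q [_ sub Cf]] := smooth_on_class 0 Cg.
rewrite /mismatch /switching.
apply: (@diff_mul_vanishing R (fun z => gfac p (z, 0)) (fun z => z.2 - Phi p 0 z.1)
  (a + M) (Num.min 1 (halfT p))).
- apply: (@continuous_comp _ _ _ (fun z : R * R => (z, 0 : 'rV[R]_nu.-2)) (gfac p)).
    exact: continuous_pairr.
  apply: (class_C_continuous Cf); apply: sub; split => //=; split => /=.
    by rewrite oppr_le0 !ltW.
  by rewrite oppr_lt0 I0.
- by rewrite addr_ge0// ltW.
- by rewrite lt_min ltr01.
move=> z; rewrite le_min => /andP[z1 zT].
have zz : `|z.1| <= `|z| by rewrite prod_normE le_max lexx.
have z1T : - halfT p <= z.1 <= halfT p by rewrite -ler_norml (le_trans zz).
have [RM _] := hR z.1 z1T.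
have -> : z.2 - Phi p 0 z.1 - z.2 = - (z.1 ^+ nu * (a + z.1 * remainder p (z.1, 0))).
  by rewrite /Phi unfolding0 aE exprS; ring.
rewrite normrN normrM mulrC; apply: ler_pM => //.
  apply: le_trans (ler_normD _ _) _; rewrite (gtr0_norm a0) lerD2l normrM.
  rewrite -[X in _ <= X]mul1r; apply: ler_pM => //; exact: le_trans zz z1.
rewrite normrX; apply: (@le_trans _ _ (`|z| ^+ nu)).
  by apply: lerXn2r; rewrite ?nnegrE.
by apply: ler_wiXn2l.
Qed.

(** The second coordinate has zero derivative along any transit of the reference
field, and the straight line is a transit. *)
Lemma outgoing_Xminus (R : realType) (nu : nat) (p : passage R nu) (q : R) :
  0 < halfT p -> - Istar p < q < Istar p -> outgoing p (@Xminus R) q = q.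
Proof.
move=> T0 qI; rewrite /outgoing; set S := (X in xget 0 X).
have Sq : S q.
  exists (2 * halfT p), (fun s => (s - halfT p, q)); split => //; split; split => //.
  - by rewrite mulr_ge0// ltW.
  - by rewrite sub0r.
  - have c1 : continuous (fun s : R => s - halfT p).
      by move=> s; apply: cvgB; [exact: cvg_id|exact: cvg_cst].
    by apply: continuous_subspaceT => s; exact: (cvg_pair (c1 s) (cvg_cst q)).
  - move=> s _; apply/is_derive_pairP; split => /=; last exact: is_derive_cst.
    have := is_deriveB (is_derive_id s (1 : R)) (is_derive_cst (halfT p) s (1 : R)).
    by rewrite subr0.
  - move=> s /andP[s0 s2]; split => //=; apply/andP; split; lra.
  - by move=> s /andP[s0 s2] /=; lra.
  - by rewrite /=; lra.
case: xgetP => [y -> [tau [gamma [[[tau0 g0 cg] [dg _ _ _]] <-]]]|/(_ q)//].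
have cy := within_snd cg.
have dy s : 0 < s < tau -> is_derive s 1 (fun s => (gamma s).2) 0.
  by move=> /dg/is_derive_pairP[].
apply/eqP; rewrite eq_le; apply/andP; split.
  have : (gamma tau).2 <= (gamma 0).2.
    by apply: (derive_le0_le tau0 cy) => s /dy ?; exists 0.
  by rewrite g0.
have : - (gamma tau).2 <= - (gamma 0).2.
  apply: (@derive_le0_le _ (fun s => - (gamma s).2) _ _ tau0).
    by move=> s; apply: cvgN; exact: cy.
  by move=> s /dy ds; exists 0 => //; rewrite -oppr0; exact: is_deriveN.
by rewrite g0 lerN2.
Qed.

Lemma compact_coord_bound (R : realType) n (K : set (R * 'rV[R]_n)) : compact K ->
  exists2 N : R, 0 < N & forall rho u, K (rho, u) ->
    `|rho| <= N /\ forall j, `|u 0 j| <= N.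
Proof.
move=> /compact_bounded[N [_ hN]]; exists (`|N| + 1); first by rewrite ltr_wpDl.
move=> rho u Kru.
have N1 : N < `|N| + 1 by rewrite (le_lt_trans (ler_norm _))// ltrDl.
have : `|(rho, u)| <= `|N| + 1 by exact: hN N1 _ Kru.
rewrite prod_normE ge_max => /andP[h1 h2].
split => // j; apply: le_trans h2; rewrite [X in _ <= X]mx_normrE.
exact: (le_bigmax _ (fun ij : 'I_1 * 'I_n => `|u ij.1 ij.2|) (0, j)).
Qed.

Theorem theorem6p3 (R : realType) (nu : nat) (a : R) (p : passage R nu) :
  (2 <= nu)%N -> ~~ odd nu -> 0 < a -> prepared p a ->
  forall K : set (R * 'rV[R]_nu.-2), compact K ->
  exists C_K r_K : R, [/\ 0 < C_K, 0 < r_K &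
    forall (rho : R) (u : 'rV[R]_nu.-2) (r : R), K (rho, u) -> 0 < r < r_K ->
      (exists (tau : R) (gamma : R -> R * R),
        transit p (Xphys p (rescale r u)) (r ^+ nu * rho) tau gamma) /\
      `|Dcap p (r ^+ nu * rho) (rescale r u) -
        mismatch p * r ^+ nu.+1 * cap a rho u| <= C_K * r ^+ nu.+2].
Proof.
move=> nu2 nue a0 prep K /compact_coord_bound[N N0 hN].
have [[T0 I0 _ _] _] := prep.
have [M [c [d [L bounds]]]] := uniform_bounds_exist nue a0 prep.
set C := 2 * (rate_const p M c L N * (1 + active_radius (nu := nu) c N (N + 1) ^+ 2)) * pi.
exists (`|C| + 1), (threshold p M c d N); split.
- by rewrite ltr_wpDl.
- exact: threshold_gt0 T0 I0 bounds N0.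
move=> rho u r Kru /andP[r0 rsmall]; have [rhoN uN] := hN rho u Kru.
have tex := transit_exists nu2 nue T0 I0 bounds N0 r0 rsmall rhoN uN prep.
split; first exact: tex.
have qI := launch_bound nu2 I0 bounds N0 r0 rsmall rhoN.
rewrite /Dcap (outgoing_Xminus T0 qI) (mismatchE nu2 nue a0 prep) /outgoing.
case: xgetP => [y -> [tau [gamma [tr <-]]]|none]; last first.
  by have [tau [gamma tr]] := tex; case: (none (gamma tau).2); exists tau, gamma.
apply: le_trans (transit_leading_order nu2 nue T0 bounds N0 r0 rsmall rhoN uN tr) _.
rewrite -/C ler_wpM2r ?exprn_ge0 ?(ltW r0)//.
by apply: le_trans (ler_norm C) _; rewrite lerDl.
Qed.
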